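(* Consider the setting described in the context, and assume A1–A5. Let $f_n=\sum_{j\ge1}\theta_{nj}\phi_j$ be a sequence in $\mathbb{L}_2(0,1)$ with $cn^{-r}\le\|f_n\|\le Cn^{-r}$ for constants $0<c<C$. Then the sequence of alternatives $f_n$ is consistent if and only if there are constants $c_1>0$, $c_2>0$ and $n_0$ such that $$\sum_{j<c_2k_n}\theta_{nj}^2>c_1n^{-2r}\quad\text{for all } n>n_0 .$$
   Context: Fix $\sigma>0$, $0<r<1/2$ and an orthonormal basis $(\phi_j)_{j\ge1}$ of $\mathbb{L}_2(0,1)$. For each $n$ one observes $dY_n(t)=f(t)\,dt+\sigma n^{-1/2}dw(t)$, $t\in[0,1]$ ($w$ standard Wiener process, $f\in\mathbb{L}_2(0,1)$ unknown), equivalently $y_j=\theta_j+\sigma n^{-1/2}\xi_j$ with $\theta_j=\int_0^1f\phi_j$, $\xi_j$ i.i.d. $N(0,1)$. The hypothesis is $H_0: f=0$. For each $n$ nonnegative weights $\kappa_{nj}^2$, $j\ge1$, are given, $\rho_n=\sum_j\kappa_{nj}^2<\infty$, and the test statistic is $T_n(Y_n)=\sum_j\kappa_{nj}^2y_j^2-\sigma^2n^{-1}\rho_n$. Put $k_n=\sup\{k:\sum_{j<k}\kappa_{nj}^2\le\rho_n/2\}$ and $\kappa_n^2=\kappa_{nk_n}^2$. Assumptions: (A1) for each $n$, $j\mapsto\kappa_{nj}^2$ is decreasing; (A2) there are $C_1,C_2>0$ with $C_1<A_n:=\sigma^{-4}n^2\sum_j\kappa_{nj}^4<C_2$ for all $n$;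 (A3) $c_1n^{-2r}\le\rho_n\le c_2n^{-2r}$ for some $c_1,c_2>0$; (A4) there are $C_1>0$ and $\lambda>1$ such that for every $\delta>0$ and every $n$, $\kappa^2_{n,[(1+\delta)k_n]}<C_1(1+\delta)^{-\lambda}\kappa_n^2$; (A5) $\kappa_{n1}^2\asymp\kappa_n^2$, and for every $c>1$ there is $C>0$ with $\kappa^2_{n,[ck_n]}\ge C\kappa_n^2$ for all $n$. A test generated by $T_n$ rejects $H_0$ iff $T_n(Y_n)$ exceeds a threshold; $\alpha(K)$ is its type I error probability and $\beta(K,f)$ its type II error probability at $f$. A sequence $f_n$ is consistent if for every $\alpha\in(0,1)$ and every sequence of tests $K_n$ generated by $T_n$ with $\alpha(K_n)=\alpha(1+o(1))$ one has $\limsup_n\beta(K_n,f_n)<1-\alpha$. Here $a_n\asymp b_n$ means $c<a_n/b_n<C$ for all $n$, and $[a]$ is the integer part. *)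

(* Defs.v *)
From HB Require Import structures.
From mathcomp Require Import all_boot all_order all_algebra.
From mathcomp Require Import all_classical all_reals all_analysis.
Set Implicit Arguments. Unset Strict Implicit. Unset Printing Implicit Defensive.
Import Order.TTheory GRing.Theory Num.Theory.
Import numFieldNormedType.Exports.
Local Open Scope classical_set_scope.
Local Open Scope ring_scope.

Section Defs.
Variable R : realType.

Definition psum (u : nat -> R) (k : nat) : R := \sum_(1 <= j < k) u j.

(* rho_n = \sum_{j >= 1} kappa_{nj}^2  (w n j stands for kappa_{nj}^2) *)
Definition rho (w : nat -> nat -> R) (n : nat) : R := limn (psum (w n)).

Definition is_kn (w : nat -> nat -> R) (n k : nat) : Prop :=
  psum (w n) k <= rho w n / 2 /\
  (forall k', psum (w n) k' <= rho w n / 2 -> (k' <= k)%N).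

Definition iid_std_normal d (T : measurableType d) (P : probability T R)
    (xi : nat -> {RV P >-> R}) : Prop :=
  (forall i (A : set R), measurable A ->
      distribution P (xi i) A = normal_prob (0:R) 1 A) /\
  (forall (s : seq nat) (B : nat -> set R), uniq s ->
      (forall i, measurable (B i)) ->
      P (\big[setI/setT]_(i <- s) (xi i @^-1` B i)) =
      (\prod_(i <- s) P (xi i @^-1` B i))%E).

(* observations y_j = theta_j + sigma n^{-1/2} xi_j, and the statistic
   T_n = \sum_j kappa_{nj}^2 y_j^2 - sigma^2 n^{-1} rho_n (extended-real valued:
   the nonnegative series is always defined, finite a.s.) *)
Definition Tstat d (T : measurableType d) (P : probability T R)
    (xi : nat -> {RV P >-> R}) (sigma : R) (w : nat -> nat -> R)
    (theta : nat -> R) (n : nat) (om : T) : \bar R :=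
  ((\sum_(1 <= j <oo)
      (w n j * (theta j + sigma / Num.sqrt n%:R * xi j om) ^+ 2)%:E)
   - (sigma ^+ 2 / n%:R * rho w n)%:E)%E.

Definition typeI d (T : measurableType d) (P : probability T R)
    (xi : nat -> {RV P >-> R}) (sigma : R) (w : nat -> nat -> R)
    (n : nat) (t : R) : \bar R :=
  P [set om | (t%:E < Tstat xi sigma w (fun _ => 0%R) n om)%E].

Definition typeII d (T : measurableType d) (P : probability T R)
    (xi : nat -> {RV P >-> R}) (sigma : R) (w : nat -> nat -> R)
    (theta : nat -> R) (n : nat) (t : R) : \bar R :=
  P [set om | (Tstat xi sigma w theta n om <= t%:E)%E].

Definition consistent d (T : measurableType d) (P : probability T R)
    (xi : nat -> {RV P >-> R}) (sigma : R) (w : nat -> nat -> R)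
    (theta : nat -> nat -> R) : Prop :=
  forall alpha : R, 0 < alpha < 1 ->
  forall t : nat -> R,
    (fun n => typeI xi sigma w n (t n)) @ \oo --> alpha%:E ->
    (limn_esup (fun n => typeII xi sigma w (theta n) n (t n)) < (1 - alpha)%:E)%E.

End Defs.

(* Main.v *)
Require Import Defs.
From HB Require Import structures.
From mathcomp Require Import all_boot all_order all_algebra.
From mathcomp Require Import all_classical all_reals all_analysis.
From mathcomp Require Import measurable_realfun ring lra.
Set Implicit Arguments. Unset Strict Implicit. Unset Printing Implicit Defensive.
Import Order.TTheory GRing.Theory Num.Theory.
Import numFieldNormedType.Exports.
Local Open Scope classical_set_scope.
Local Open Scope ring_scope.

(** Multiplied by n^2, the statistic is a sum of independent terms
    [a_j (xi_j^2 - E xi^2) + 2 b_j xi_j] plus the shift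
    [D_n = n^2 \sum_j kappa_nj^2 theta_nj^2] and a constant, with
    [a_j = sigma^2 n kappa_nj^2] and [b_j^2 = a_j d_j], [d_j] being the terms of [D_n].
    By A1-A3 and A5, [kappa_n1^2] is of exact order [n^(2r - 2)]; since [r < 1/2], all the
    coefficients tend to 0 uniformly while [\sum_j a_j^2] stays bounded away from 0 and
    infinity. A Lindeberg replacement with test functions [Phi ((m - x) / sqrt v)], a family
    preserved by adding a Gaussian variable (which only increases [v]), gives the normal
    approximation of the law of the statistic uniformly in the threshold. The second error
    probability is thus [Phi ((x_n - D_n) / s_n) + o(1)] where [Phi (x_n / s_n)] tends to
    [1 - alpha], so consistency means that [D_n] is bounded away from 0. For the converse it
    suffices to use the tests with [x_n = 0], i.e. [alpha = 1 - Phi 0]. Finally A4 makes the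
    contribution of the frequencies [j >= c k_n] to [D_n] small for large [c], and A5 bounds
    the weights below for [j < c k_n], which turns the condition on [D_n] into the one on
    [\sum_{j < c k_n} theta_nj^2]. *)

(** * Standard normal distribution function and Taylor bounds *)

(** The replacement needs no Gaussian companion variables: the Gaussian side is the closed form
    [Phi ((m - x) / sqrt v)], so one step compares two expansions, Taylor in the increment and heat
    flow in [v], whose second-order terms agree. The remaining cost per summand adds up to a
    multiple of [e * \sum_j (a_j^2 + b_j^2)], with [e] a bound on all coefficients, whatever the
    number of summands.

    Indicators are not of this form. Dilating the statistic by a large [lam] makes the test function
    steep compared with its spread; the constants are chosen in the order tolerance, tail cutoff,
    [lam], [e]. As the statistic is an infinite series, partial sums are treated uniformly in their
    length, and the limit is taken along decreasing events.

    The alternative increases the variance by a multiple of [\sum_j b_j^2 <= a_1 D_n], which tends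
    to 0 because the norm condition bounds [D_n]. Thresholds are a priori unbounded; a limiting
    level inside (0, 1) confines [x_n / s_n] to a bounded interval, where the slope of [Phi] is
    bounded below. *)

Section StandardNormal.
Variable R : realType.
Implicit Types x y z h u K : R.

Definition phi x : R := normal_pdf 0 1 x.

Definition Phi x : R :=
  \int[lebesgue_measure]_(t in `]-oo, x]) phi t.

Lemma phiE x : phi x = normal_peak 1 * expR (- (x ^+ 2) / 2).
Proof.
rewrite /phi normal_pdfE ?oner_neq0// /normal_fun subr0 expr1n.
by congr (_ * expR (_ / _)).
Qed.

Lemma phi_gt0 x : 0 < phi x.
Proof. by rewrite phiE mulr_gt0 ?expR_gt0// normal_peak_gt0 ?oner_neq0. Qed.

Lemma phi_ge0 x : 0 <= phi x. Proof. exact/ltW/phi_gt0. Qed.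

Lemma is_derive_phi x : is_derive x 1 phi (- x * phi x).
Proof.
have -> : phi = fun x => normal_peak 1 * expR (- (x ^+ 2) / 2).
  by apply/funext => y; exact: phiE.
apply: is_derive_eq.
by rewrite /GRing.scale /=; field.
Qed.

Lemma is_derive_Phi x : is_derive x 1 Phi (phi x).
Proof.
have xx1 : x < x + 1 by rewrite ltrDl.
have [] := @continuous_FTC1 R phi (BInfty _ true) x _ xx1.
- apply: (integrableS measurableT) => //; exact: integrable_normal_pdf.
- by rewrite ltNyr.
- exact: continuous_normal_pdf (oner_neq0 _) _.
move=> dF F'; apply: DeriveDef; first exact: dF.
by rewrite -derive1E F'.
Qed.

Lemma mean_value_bound (f df : R -> R) x y K :
  (forall z, `|z - x| <= `|y - x| -> is_derive z 1 f (df z)) ->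
  (forall z, `|z - x| <= `|y - x| -> `|df z| <= K) ->
  `|f y - f x| <= K * `|y - x|.
Proof.
move=> dfz dfK.
have cont a b : (forall z, z \in `[a, b] -> `|z - x| <= `|y - x|) ->
    {within `[a, b], continuous f}.
  move=> ab; apply: derivable_within_continuous => z zab.
  by have [] := dfz z (ab _ zab).
have [xy|/ltW yx] := leP x y.
- have sub z : z \in `[x, y] -> `|z - x| <= `|y - x|.
    rewrite in_itv/= => /andP[xz zy].
    by rewrite !ger0_norm ?subr_ge0// lerD2r.
  have [|c cxy ->] := @MVT_segment R f df _ _ xy _ (cont _ _ sub).
    by move=> z /subset_itv_oo_cc/sub/dfz.
  by rewrite normrM ler_wpM2r// dfK// sub.
- have sub z : z \in `[y, x] -> `|z - x| <= `|y - x|.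
    rewrite in_itv/= => /andP[yz zx].
    by rewrite !ler0_norm ?subr_le0// lerN2 lerD2r.
  have [|c cxy E] := @MVT_segment R f df _ _ yx _ (cont _ _ sub).
    by move=> z /subset_itv_oo_cc/sub/dfz.
  by rewrite distrC E normrM (distrC y) ler_wpM2r// dfK// sub.
Qed.

(** The mean value bound is applied to the remainder [g], whose derivative is controlled by the same
    bound for [f1]. This gives the constant [K] in place of [K / 2]. *)
Lemma taylor2_bound (f f1 f2 : R -> R) x y K :
  (forall z, `|z - x| <= `|y - x| -> is_derive z 1 f (f1 z)) ->
  (forall z, `|z - x| <= `|y - x| -> is_derive z 1 f1 (f2 z)) ->
  (forall z, `|z - x| <= `|y - x| -> `|f2 z| <= K) ->
  `|f y - f x - f1 x * (y - x)| <= K * `|y - x| ^+ 2.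
Proof.
move=> d1 d2 f2K.
pose g z := f z - f1 x * (z - x).
have dg z : `|z - x| <= `|y - x| -> is_derive z 1 g (f1 z - f1 x).
  move=> zy; have df := d1 z zy; rewrite /g.
  apply: is_derive_eq; rewrite /GRing.scale /=; ring.
have gK z : `|z - x| <= `|y - x| -> `|f1 z - f1 x| <= K * `|y - x|.
  move=> zy.
  have := @mean_value_bound f1 f2 x z K.
  move=> /(_ (fun t tz => d2 t (le_trans tz zy)) (fun t tz => f2K t (le_trans tz zy))).
  move=> /le_trans; apply; apply: ler_wpM2l => //.
  by apply: le_trans (f2K x _); rewrite ?subrr ?normr0.
have := mean_value_bound dg gK.
rewrite /g subrr mulr0 subr0 expr2 mulrA.
by rewrite (_ : f y - _ - _ = f y - f x - f1 x * (y - x)); last ring.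
Qed.

Lemma taylor3_bound (f f1 f2 f3 : R -> R) x y K :
  (forall z, is_derive z 1 f (f1 z)) -> (forall z, is_derive z 1 f1 (f2 z)) ->
  (forall z, is_derive z 1 f2 (f3 z)) -> (forall z, `|f3 z| <= K) ->
  `|f y - f x - f1 x * (y - x) - f2 x * (y - x) ^+ 2 / 2| <= K * `|y - x| ^+ 3.
Proof.
move=> d1 d2 d3 f3K.
pose g z := f z - f1 x * (z - x) - f2 x * (z - x) ^+ 2 / 2.
have dg z : `|z - x| <= `|y - x| ->
    is_derive z 1 g (f1 z - f1 x - f2 x * (z - x)).
  move=> _; have df := d1 z; rewrite /g.
  by apply: is_derive_eq; rewrite /GRing.scale /=; field.
have gK z : `|z - x| <= `|y - x| ->
    `|f1 z - f1 x - f2 x * (z - x)| <= K * `|y - x| ^+ 2.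
  move=> zy.
  have := @taylor2_bound f1 f2 f3 x z K (fun t _ => d2 t) (fun t _ => d3 t) (fun t _ => f3K t).
  move=> /le_trans; apply; apply: ler_wpM2l; last by rewrite lerXn2r ?nnegrE.
  by apply: le_trans (f3K x).
have := mean_value_bound dg gK.
rewrite -mulrA -[_ ^+ 2 * `|y - x|]exprSr.
rewrite /g subrr expr0n !mulr0 mul0r !subr0.
by apply: le_trans; rewrite le_eqVlt; apply/orP; left; apply/eqP; congr `|_|; ring.
Qed.

(** Derivatives of [Phi] up to order three, and of its dilations, are [phi] times polynomials of
    degree at most three. They are bounded since [expR (x^2 / 2)] is the fourth power of
    [expR (x^2 / 8) >= 1 + x^2 / 8], which outgrows a cubic. *)
Lemma phi_moment_bound : exists2 K : R, 0 < K &
  forall x, (1 + `|x| ^+ 3) * phi x <= K.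
Proof.
pose k : R := normal_peak 1.
have k0 : 0 < k by rewrite normal_peak_gt0 ?oner_neq0.
exists (2 * 64 * k); first by rewrite !mulr_gt0.
move=> x; rewrite phiE -/k.
have -> : (1 + `|x| ^+ 3) * (k * expR (- x ^+ 2 / 2)) =
  k * ((1 + `|x| ^+ 3) * expR (- x ^+ 2 / 2)) by ring.
rewrite mulrC ler_pM2r// mulNr expRN ler_pdivrMr ?expR_gt0//.
have e1 : 1 + x ^+ 2 / 8 <= expR (x ^+ 2 / 8) by exact: expR_ge1Dx.
have -> : expR (x ^+ 2 / 2) = expR (x ^+ 2 / 8) ^+ 4.
  by rewrite -expRM_natl; congr expR; field.
have x2 : x ^+ 2 = `|x| ^+ 2 by rewrite -normrX ger0_norm ?sqr_ge0.
have h0 := normr_ge0 x.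
apply: (@le_trans _ _ (2 * 64 * (1 + x ^+ 2 / 8) ^+ 4)); last first.
  rewrite ler_wpM2l// lerXn2r ?nnegrE ?expR_ge0// addr_ge0// divr_ge0 ?sqr_ge0//.
rewrite x2; set a := `|x| in h0 *.
nra.
Qed.

Lemma Phi_taylor3 : exists2 K : R, 0 < K & forall x h,
  `|Phi (x + h) - Phi x - phi x * h + x * phi x * h ^+ 2 / 2| <= K * `|h| ^+ 3.
Proof.
have [K K0 phiK] := phi_moment_bound.
exists (2 * K); first by rewrite mulr_gt0.
move=> x h.
have d3 z : is_derive z 1 (fun x => - x * phi x) ((z ^+ 2 - 1) * phi z).
  have dp := is_derive_phi z.
  apply: is_derive_eq; rewrite /GRing.scale /=; ring.
have b3 z : `|(z ^+ 2 - 1) * phi z| <= 2 * K.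
  apply: le_trans (_ : 2 * ((1 + `|z| ^+ 3) * phi z) <= _); last first.
    by rewrite ler_pM2l.
  rewrite normrM (ger0_norm (phi_ge0 z)) mulrA ler_wpM2r ?phi_ge0//.
  have z2 : z ^+ 2 = `|z| ^+ 2 by rewrite -normrX ger0_norm ?sqr_ge0.
  rewrite z2; have := normr_ge0 z; set a := `|z| => a0.
  have := mulr_ge0 a0 (sqr_ge0 (a - 1)); have := sqr_ge0 (a - 1).
  rewrite ler_norml => h1 h2; apply/andP; split; nra.
have := @taylor3_bound Phi phi _ _ x (x + h) (2 * K) is_derive_Phi is_derive_phi d3 b3.
rewrite (addrC x h) addrK.
by rewrite (_ : _ - _ - _ - - x * _ * _ / 2 = Phi (h + x) - Phi x - phi x * h + x * phi x * h ^+ 2 / 2) //; ring.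
Qed.

(** Uniformity in [z] is the point: the second derivative in [u] carries [z^3], and [u <= 1 / 2]
    keeps [z] comparable with the argument of [phi], which then absorbs the cube. *)
Lemma Phi_scale : exists2 K : R, 0 < K & forall z u, 0 <= u <= 1 / 2 ->
  `|Phi (z * (1 - u)) - Phi z + z * phi z * u| <= K * u ^+ 2.
Proof.
have [K K0 phiK] := phi_moment_bound.
exists (8 * K); first by rewrite mulr_gt0.
move=> z u /andP[u0 u2].
pose f v := Phi (z * (1 - v)).
pose f1 v : R := - z * phi (z * (1 - v)).
pose f2 v : R := - (z ^+ 3) * (1 - v) * phi (z * (1 - v)).
have dl (v : R) : is_derive v 1 (fun v => z * (1 - v)) (- z).
  by apply: is_derive_eq; rewrite /GRing.scale /=; ring.
have d1 (v : R) : is_derive v 1 f (f1 v).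
  have dP := is_derive_Phi (z * (1 - v)).
  have := @is_derive1_comp R Phi (fun v => z * (1 - v)) v _ _ dP (dl v).
  by move=> H; apply: is_derive_eq; rewrite /f1 /GRing.scale /=; ring.
have d2 (v : R) : is_derive v 1 f1 (f2 v).
  have dP := is_derive_phi (z * (1 - v)).
  have D := @is_derive1_comp R phi (fun v => z * (1 - v)) v _ _ dP (dl v).
  have D2 : is_derive v 1 (phi \o (fun v => z * (1 - v))) (- (z * (1 - v)) * phi (z * (1 - v)) * - z).
    by apply: is_derive_eq; rewrite /GRing.scale /=.
  have := is_deriveZ (- z) D2.
  by move=> H; apply: is_derive_eq; rewrite /f2 /GRing.scale /=; ring.
have := @taylor2_bound f f1 f2 0 u (8 * K) (fun v _ => d1 v) (fun v _ => d2 v).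
rewrite /f /f1 !subr0 mulr1 (ger0_norm u0).
rewrite (_ : _ - _ - - z * _ * _ = Phi (z * (1 - u)) - Phi z + z * phi z * u); last ring.
apply=> v; rewrite subr0 => vu.
have v1 : 1 / 2 <= 1 - v.
  by have := ler_norm v; lra.
have v2 : 1 - v <= 3 / 2.
  by have := ler_norm (- v); rewrite normrN; lra.
set q := z * (1 - v).
apply: le_trans (_ : 8 * ((1 + `|q| ^+ 3) * phi q) <= _); last by rewrite ler_pM2l.
rewrite /f2 -/q normrM (ger0_norm (phi_ge0 _)) mulrA ler_wpM2r ?phi_ge0//.
rewrite normrM normrN normrX /q normrM (ger0_norm (_ : 0 <= 1 - v)); last lra.
rewrite exprMn.
have z3 : 0 <= `|z| ^+ 3 by rewrite exprn_ge0.
set Z := `|z| ^+ 3 in z3 *; set w := 1 - v in v1 v2 *.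
have w3 : w <= 8 * w ^+ 3 by nra.
nra.
Qed.

End StandardNormal.

(** * Moments of the standard normal law *)

Section GaussianMeasure.
Variable R : realType.
Implicit Types x y z K : R.

Local Notation gamma := (@normal_prob R 0 1).
Local Notation leb := (@lebesgue_measure R).

(** The change of variables goes through the Radon-Nikodym derivative, which is identified with
    [phi] only almost everywhere, by comparing integrals over measurable sets. *)
Lemma ge0_integral_normal (f : R -> R) :
  measurable_fun setT f -> (forall x, 0 <= f x) ->
  (\int[gamma]_x (f x)%:E = \int[leb]_x (f x * phi x)%:E)%E.
Proof.
move=> mf f0.
have dom := @normal_prob_dominates R 0 1.
have mfE : measurable_fun setT (EFin \o f) by exact/measurable_EFinP.
have fE0 x : (0 <= (EFin \o f) x)%E by rewrite lee_fin.
rewrite -(Radon_Nikodym_SigmaFinite.change_of_variables dom fE0 measurableT mfE).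
have mRN := measurable_int _ (Radon_Nikodym_SigmaFinite.f_integrable dom).
have mphi : measurable_fun setT (EFin \o @phi R).
  by apply/measurable_EFinP; exact: measurable_normal_pdf.
apply: ae_eq_integral => //.
- exact: emeasurable_funM.
- have -> : (fun x => (f x * phi x)%:E) = (fun x => (f x)%:E * (phi x)%:E)%E.
    by apply/funext => x; rewrite EFinM.
  exact: emeasurable_funM.
apply: (@filterS _ _ _ (fun x => setT x -> Radon_Nikodym_SigmaFinite.f gamma leb x = (phi x)%:E)).
- exact: (ae_filter_ringOfSetsType leb).
- by move=> x /(_ I) E _; rewrite E EFinM.
apply: integral_ae_eq => //.
- exact: Radon_Nikodym_SigmaFinite.f_integrable.
- by move=> A _ mA; rewrite -Radon_Nikodym_SigmaFinite.f_integral.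
Qed.

(** [phi] is even. The integral is cut at 0 because the substitution is made on half lines, where
    the reflection exchanges the two pieces. *)
Lemma ge0_integral_normalN (f : R -> R) :
  continuous f -> (forall x, 0 <= f x) ->
  (\int[gamma]_x (f (- x))%:E = \int[gamma]_x (f x)%:E)%E.
Proof.
move=> cf f0.
have mf : measurable_fun setT f by exact: continuous_measurable_fun.
have cN : continuous (f \o -%R).
  by move=> x; apply: continuous_comp; [exact: opp_continuous|exact: cf].
have mN : measurable_fun setT (f \o -%R) by exact: continuous_measurable_fun.
rewrite (@ge0_integral_normal (f \o -%R)) ?ge0_integral_normal//; last by move=> x /=.
pose g x := f x * phi x.
have phiN x : phi (- x) = phi x by rewrite !phiE sqrrN.
have -> : (\int[leb]_x ((f \o -%R) x * phi x)%:E = \int[leb]_x (g (- x))%:E)%E.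
  by apply: eq_integral => x _; rewrite /g /= phiN.
have cg : continuous g.
  move=> x; apply: continuousM; [exact: cf|].
  exact: continuous_normal_pdf (oner_neq0 _) _.
have cgN : continuous (g \o -%R).
  by move=> x; apply: continuous_comp; [exact: opp_continuous|exact: cg].
have g0 x : 0 <= g x by rewrite mulr_ge0 ?phi_ge0.
have split_int (k : R -> R) : continuous k -> (forall x, 0 <= k x) ->
  (\int[leb]_x (k x)%:E = \int[leb]_(x in `[0%R, +oo[) (k x)%:E
     + \int[leb]_(x in `[0%R, +oo[) (k (- x))%:E)%E.
  move=> ck k0.
  have mk : measurable_fun setT k by exact: continuous_measurable_fun.
  rewrite -(setUv `[0%R, +oo[%classic) ge0_integral_setU//=; last 4 first.
    exact: measurableC.
    by apply/measurable_EFinP; rewrite setUv.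
    by move=> x _; rewrite lee_fin.
    exact/disj_setPCl.
  rewrite setCitvr; congr (_ + _)%E.
  rewrite integral_itv_bndo_bndc; last exact/measurable_EFinP/measurable_funTS.
  rewrite -{1}oppr0 ge0_integration_by_substitutionNy//.
  exact: continuous_subspaceT.
have gN0 x : 0 <= (g \o -%R) x by exact: g0.
rewrite (split_int (g \o -%R) cgN gN0) (split_int g cg g0) [RHS]addeC.
congr (_ + _)%E; apply: eq_integral => x _; congr EFin; rewrite /comp opprK.
by [].
Qed.

(** Degree six is that of the third absolute moment of a quadratic increment. The integrand is
    dominated by a multiple of the normal density of standard deviation 2, because
    [expR (- x^2 / 8)] is [expR (- x^2 / 2)] times the cube of [expR (x^2 / 8)]. *)
Lemma normal_moment6 : (\int[gamma]_x (1 + `|x| ^+ 6)%:E < +oo)%E.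
Proof.
have m6 : measurable_fun setT (fun x : R => 1 + `|x| ^+ 6).
  apply: measurable_funD => //; apply: measurable_funX; exact: normr_measurable.
rewrite ge0_integral_normal//.
have [c c0 cP] : exists2 c : R, 0 < c & forall a, 0 <= a -> 1 + a ^+ 3 <= c * (1 + a / 8) ^+ 3.
  (* 513 is [8 ^ 3 + 1]: 512 for the cubic term and 1 for the constant. *)
  by exists 513 => [|a a0]; [rewrite ltr0n|nra].
pose K : R := c * normal_peak 1 / normal_peak 2.
have p1 : 0 < normal_peak 1 :> R by rewrite normal_peak_gt0 ?oner_neq0.
have p2 : 0 < normal_peak 2 :> R by rewrite normal_peak_gt0.
apply: (@le_lt_trans _ _ (\int[leb]_x (K%:E * (normal_pdf 0 2 x)%:E))%E).
  apply: ge0_le_integral => //.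
  - by move=> x _; rewrite lee_fin mulr_ge0 ?phi_ge0// addr_ge0// exprn_ge0.
  - apply/measurable_EFinP/measurable_funM => //; exact: measurable_normal_pdf.
  - apply: emeasurable_funM => //; apply/measurable_EFinP; exact: measurable_normal_pdf.
  move=> x _; rewrite -EFinM lee_fin phiE normal_pdfE ?pnatr_eq0// /normal_fun subr0 /K.
  have -> : c * normal_peak 1 / normal_peak 2 * (normal_peak 2 * expR (- x ^+ 2 / (2 ^+ 2 *+ 2)))
     = normal_peak 1 * (c * expR (- x ^+ 2 / (2 ^+ 2 *+ 2))).
    by field; rewrite gt_eqF.
  rewrite mulrCA ler_pM2l//.
  have -> : expR (- x ^+ 2 / (2 ^+ 2 *+ 2)) = expR (- x ^+ 2 / 2) * expR (x ^+ 2 / 8) ^+ 3.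
    by rewrite -expRM_natl -expRD; congr expR; field.
  rewrite mulrCA mulrC ler_pM2l ?expR_gt0//.
  have e1 : 1 + x ^+ 2 / 8 <= expR (x ^+ 2 / 8) by exact: expR_ge1Dx.
  apply: (@le_trans _ _ (c * (1 + x ^+ 2 / 8) ^+ 3)); last first.
    apply: ler_wpM2l; first exact: ltW.
    rewrite lerXn2r ?nnegrE ?expR_ge0// addr_ge0 ?ler01//.
    by rewrite divr_ge0 ?sqr_ge0 ?ler0n.
  have -> : `|x| ^+ 6 = (x ^+ 2) ^+ 3.
    by rewrite -exprM -normrX ger0_norm// (exprM x 2 3) exprn_ge0// sqr_ge0.
  exact/cP/sqr_ge0.
rewrite ge0_integralZl//.
- by rewrite integral_normal_pdf mule1 ltry.
- by apply/measurable_EFinP; exact: measurable_normal_pdf.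
- by move=> x _; rewrite lee_fin normal_pdf_ge0.
- by rewrite lee_fin ltW// /K divr_gt0// mulr_gt0.
Qed.

Lemma integrable_normal_poly (f : R -> R) K : measurable_fun setT f ->
  (forall x, `|f x| <= K * (1 + `|x| ^+ 6)) -> gamma.-integrable setT (EFin \o f).
Proof.
move=> mf fK.
apply: (@le_integrable _ _ _ gamma setT measurableT (EFin \o f) (fun x => K%:E * (1 + `|x| ^+ 6)%:E)%E) => //.
- exact/measurable_EFinP.
- move=> x _ /=; rewrite lee_fin; apply: le_trans (fK x) _.
  exact: ler_norm.
apply: integrableZl => //; apply/integrableP; split.
  apply/measurable_EFinP; apply: measurable_funD => //.
  by apply: measurable_funX; exact: normr_measurable.
apply: le_lt_trans normal_moment6.
apply: ge0_le_integral => //.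
- apply: measurableT_comp => //; apply/measurable_EFinP; apply: measurable_funD => //.
  by apply: measurable_funX; exact: normr_measurable.
- apply/measurable_EFinP; apply: measurable_funD => //.
  by apply: measurable_funX; exact: normr_measurable.
by move=> x _ /=; rewrite lee_fin ger0_norm// addr_ge0// exprn_ge0.
Qed.

(** Reflection is available for nonnegative functions, and it exchanges the positive and negative
    parts of an odd function. *)
Lemma Rintegral_normal_odd (f : R -> R) K : continuous f ->
  (forall x, f (- x) = - f x) ->
  (forall x, `|f x| <= K * (1 + `|x| ^+ 6)) -> \int[gamma]_x f x = 0.
Proof.
move=> cf fN fK.
pose fp x : R := Num.max (f x) 0; pose fn x : R := Num.max (- f x) 0.
have c0 : continuous (fun _ : R => 0 : R) by move=> x; exact: cst_continuous.
have cNf : continuous (fun x => - f x) by move=> x; apply: continuousN; exact: cf.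
have cp : continuous fp by move=> x; apply: continuous_max; [exact: cf|exact: c0].
have cn : continuous fn by move=> x; exact: (@continuous_max _ _ (fun x => - f x) (fun=> 0) x (cNf x) (c0 x)).
have ip : gamma.-integrable setT (EFin \o fp).
  apply: (@integrable_normal_poly _ K); first exact: continuous_measurable_fun.
  move=> x; apply: le_trans (fK x); rewrite /fp.
  by rewrite maxEle; case: ifP => _; rewrite ?normr0 ?normr_ge0.
have in_ : gamma.-integrable setT (EFin \o fn).
  apply: (@integrable_normal_poly _ K); first exact: continuous_measurable_fun.
  move=> x; apply: le_trans (fK x); rewrite /fn.
  by rewrite maxEle; case: ifP => _; rewrite ?normr0 ?normrN ?normr_ge0.
have fE x : f x = fp x - fn x.
  rewrite /fp /fn !maxEle; case: (leP (f x) 0); case: (leP (- f x) 0) => *; lra.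
rewrite (@eq_Rintegral _ _ _ gamma setT (fun x => fp x - fn x)); last by move=> x _; exact: fE.
rewrite RintegralB//; apply/eqP; rewrite subr_eq0; apply/eqP.
rewrite /Rintegral; congr fine.
rewrite -[RHS]ge0_integral_normalN//; last first.
  by move=> x; rewrite /fn le_max lexx orbT.
by apply: eq_integral => x _; rewrite /fn /fp fN opprK.
Qed.

(* These are 1 and 2, but only their finiteness and [0 < tau] matter. *)
Definition mu2 : R := \int[gamma]_x (x ^+ 2).

Definition tau : R := \int[gamma]_x ((x ^+ 2 - mu2) ^+ 2).

Lemma mu2_ge0 : 0 <= mu2.
Proof. by apply: Rintegral_ge0 => x _; exact: sqr_ge0. Qed.

Lemma integrable_sqr_center : gamma.-integrable setT
  (EFin \o (fun x => (x ^+ 2 - mu2) ^+ 2)).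
Proof.
apply: (@integrable_normal_poly _ (4 * (1 + mu2 ^+ 2))).
  by apply: measurable_funX; apply: measurable_funB => //; exact: measurable_funX.
move=> x; rewrite ger0_norm ?sqr_ge0//.
have -> : `|x| ^+ 6 = (x ^+ 2) ^+ 3.
  by rewrite -exprM -normrX ger0_norm// (exprM x 2 3) exprn_ge0// sqr_ge0.
have := sqr_ge0 x; set a := x ^+ 2 => a0; have := mu2_ge0; set m := mu2 => m0.
have h1 : a ^+ 2 <= 1 + a ^+ 3.
  have := mulr_ge0 a0 (sqr_ge0 (a - 1)); have := sqr_ge0 (a - 1); nra.
have a3 : 0 <= a ^+ 3 by rewrite exprn_ge0.
have : 0 <= m ^+ 2 * a ^+ 3 by rewrite mulr_ge0// sqr_ge0.
have := mulr_ge0 a0 m0; have := sqr_ge0 m; lra.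
Qed.

(** If [tau] were 0, [x^2] would equal [mu2] almost surely, so the normal law would be carried by
    two points, a Lebesgue null set. *)
Lemma tau_gt0 : 0 < tau.
Proof.
have tau0 : 0 <= tau by apply: Rintegral_ge0 => x _; exact: sqr_ge0.
rewrite lt_neqAle tau0 andbT; apply/eqP => t0.
have I0 : (\int[gamma]_x ((x ^+ 2 - mu2) ^+ 2)%:E = 0)%E.
  rewrite -[LHS]fineK; last exact: integrable_fin_num integrable_sqr_center.
  by rewrite -[fine _]/tau -t0.
have : ae_eq gamma setT (fun x => ((x ^+ 2 - mu2) ^+ 2)%:E) (cst 0%E).
  apply/(@ae_eq_integral_abs _ _ _ gamma) => //.
    by have /integrableP[] := integrable_sqr_center.
  rewrite -[RHS]I0; apply: eq_integral => x _; rewrite /= ger0_norm// sqr_ge0//.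
move=> [N [mN N0 sub]].
have : gamma [set: R] = 0%E.
  pose s := Num.sqrt mu2.
  have fin0 : gamma [set s; - s] = 0%E.
    have /null_content_dominatesP := @normal_prob_dominates R 0 1.
    apply; first by apply: measurableU.
    apply/eqP; rewrite eq_le measure_ge0 andbT.
    apply: le_trans (measureU2 _ _ _) _ => //.
    rewrite [X in (X + _)%E](_ : _ = 0%E); last exact: lebesgue_measure_set1.
    by rewrite [X in (_ + X)%E](_ : _ = 0%E) ?adde0//; exact: lebesgue_measure_set1.
  apply/eqP; rewrite eq_le measure_ge0 andbT.
  apply: (@le_trans _ _ (gamma (N `|` [set s; - s]))).
    apply: le_measure; rewrite ?inE//.
      by apply: measurableU => //; apply: measurableU.
    move=> x _; have [Nx|nNx] := pselect (N x); [by left|right].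
    have : ~ ~ (setT x -> ((x ^+ 2 - mu2) ^+ 2)%:E = 0%E) by move=> h; apply: nNx; exact: sub.
    move=> /contrapT /(_ I) [] /eqP; rewrite sqrf_eq0 subr_eq0 => /eqP xm.
    have /eqP : x ^+ 2 = s ^+ 2 by rewrite sqr_sqrtr ?mu2_ge0.
    by rewrite eqf_sqr => /orP[] /eqP ->; [left|right].
  apply: le_trans (measureU2 _ _ _) _ => //; first by apply: measurableU.
  by rewrite [X in (X + _)%E]N0 [X in (_ + X)%E]fin0 adde0.
by rewrite probability_setT => /eqP; rewrite onee_eq0.
Qed.

End GaussianMeasure.

(** * One replacement step *)

Section OneStep.
Variable R : realType.
Implicit Types x y z a b e h K : R.

Local Notation gamma := (@normal_prob R 0 1).
Local Notation L1 f := (gamma.-integrable setT (EFin \o f)).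

Lemma PhiE x : (Phi x)%:E = gamma `]-oo, x].
Proof.
have -> : Phi x = fine (gamma `]-oo, x]) by [].
by rewrite fineK// fin_num_measure.
Qed.

Lemma Phi_ge0 x : 0 <= Phi x.
Proof. by rewrite -lee_fin PhiE measure_ge0. Qed.

Lemma Phi_le1 x : Phi x <= 1.
Proof. by rewrite -lee_fin PhiE probability_le1. Qed.

Lemma continuous_Phi : continuous (@Phi R).
Proof.
move=> x; apply: differentiable_continuous; apply/derivable1_diffP.
by have [] := is_derive_Phi x.
Qed.

Lemma measurable_Phi : measurable_fun setT (@Phi R).
Proof. by apply: continuous_measurable_fun; exact: continuous_Phi. Qed.

Lemma norm_le_cube x : `|x| <= 1 + `|x| ^+ 3.
Proof.
have [x1|/ltW x1] := leP `|x| 1.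
- by apply: le_trans x1 _; rewrite lerDl exprn_ge0.
- by apply: le_trans (_ : `|x| ^+ 3 <= _); [rewrite -[leLHS]expr1 ler_weXn2l|rewrite lerDr ler01].
Qed.

Lemma Rintegral_normal_cst x : \int[gamma]_(_ in setT) x = x.
Proof.
rewrite Rintegral_cst//= [X in fine X](_ : _ = 1%E) ?mulr1//.
exact: probability_setT.
Qed.

(** [Phi (z / sqrt (1 + h))] is [Phi] convolved with a centred Gaussian of variance [h], so its
    first-order term is [h / 2] times the second derivative [- z * phi z]. The bound [h <= 3] gives
    [sqrt (1 + h) <= 2], hence a dilation [u = 1 - 1 / sqrt (1 + h)] of at most 1 / 2, as
    [Phi_scale] requires. *)
Lemma Phi_heat : exists2 K : R, 0 < K & forall z h, 0 <= h <= 3 ->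
  `|Phi (z / Num.sqrt (1 + h)) - Phi z + h / 2 * (z * phi z)| <= K * h ^+ 2.
Proof.
have [K1 K10 K1P] := phi_moment_bound R.
have [K2 K20 K2P] := Phi_scale R.
exists (K2 + 2 * K1); first by rewrite addr_gt0// mulr_gt0.
move=> z h /andP[h0 h3].
set s := Num.sqrt (1 + h).
have s2 : s ^+ 2 = 1 + h by rewrite sqr_sqrtr// addr_ge0.
have s1 : 1 <= s by rewrite -[leLHS]sqrtr1 ler_sqrt ?addr_gt0 ?ler01//; lra.
have s3 : s <= 2 by have := sqr_ge0 s; nra.
have s0 : 0 < s by lra.
pose u := 1 - s^-1.
have us : u * s = s - 1 by rewrite /u mulrBl mul1r mulVf// gt_eqF.
have u0 : 0 <= u by rewrite -(pmulr_lge0 _ s0) us; lra.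
have u1 : u <= 1 / 2.
  by rewrite -(ler_pM2r s0) us; lra.
have hE : h = s ^+ 2 - 1 by rewrite s2; ring.
have uh : u <= h / 2.
  rewrite -(ler_pM2r s0) us hE -subr_ge0.
  have -> : (s ^+ 2 - 1) / 2 * s - (s - 1) = (s - 1) ^+ 2 * ((s + 2) / 2) by field.
  by rewrite mulr_ge0 ?sqr_ge0//; lra.
have hu : h / 2 - u <= h ^+ 2.
  rewrite -(ler_pM2r s0) mulrBl us hE.
  have : 0 <= (s - 1) ^+ 2 by exact: sqr_ge0.
  have -> : (s ^+ 2 - 1) ^+ 2 * s = (s - 1) ^+ 2 * (s * (s + 1) ^+ 2) by ring.
  have -> : (s ^+ 2 - 1) / 2 * s - (s - 1) = (s - 1) ^+ 2 * ((s + 2) / 2) by field.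
  move=> ss; apply: ler_wpM2l => //; nra.
have -> : z / s = z * (1 - u) by rewrite /u; congr (_ * _); ring.
have zphi : `|z * phi z| <= 2 * K1.
  rewrite normrM (ger0_norm (phi_ge0 z)).
  apply: le_trans (_ : 2 * ((1 + `|z| ^+ 3) * phi z) <= _); last by rewrite ler_pM2l.
  rewrite mulrA ler_wpM2r ?phi_ge0//.
  have := norm_le_cube z; have := exprn_ge0 3 (normr_ge0 z); lra.
have -> : Phi (z * (1 - u)) - Phi z + h / 2 * (z * phi z) =
  (Phi (z * (1 - u)) - Phi z + z * phi z * u) + (h / 2 - u) * (z * phi z) by ring.
apply: le_trans (ler_normD _ _) _; rewrite [leRHS]mulrDl lerD//.
- apply: le_trans (K2P z u _) _; first by rewrite u0.
  by rewrite ler_pM2l//; nra.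
- rewrite normrM (ger0_norm (_ : 0 <= h / 2 - u)) ?subr_ge0// mulrC.
  by apply: ler_pM => //; rewrite subr_ge0.
Qed.

Lemma norm_exp_le6 x k : (k <= 6)%N -> `|x| ^+ k <= 1 + `|x| ^+ 6.
Proof.
move=> k6; have [x1|/ltW x1] := leP `|x| 1.
- by apply: le_trans (_ : 1 <= _); rewrite ?lerDl ?exprn_ge0// exprn_ile1.
- by apply: le_trans (_ : `|x| ^+ 6 <= _); rewrite ?lerDr ?ler01// ler_weXn2l.
Qed.

Lemma integrable_EFinD (f g : R -> R) : L1 f -> L1 g -> L1 (fun x => f x + g x).
Proof. by move=> If Ig; exact: (integrableD measurableT If Ig). Qed.

Lemma integrable_EFinZ (f : R -> R) c : L1 f -> L1 (fun x => c * f x).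
Proof. by move=> If; exact: (integrableZl measurableT c If). Qed.

Lemma integrable_normal_exp k : (k <= 6)%N -> L1 (fun x => x ^+ k).
Proof.
move=> k6; apply: (@integrable_normal_poly R _ 1).
  exact: measurable_funX.
by move=> x; rewrite mul1r normrX norm_exp_le6.
Qed.

Lemma integrable_bounded1 (f : R -> R) : measurable_fun setT f ->
  (forall x, 0 <= f x <= 1) -> L1 f.
Proof.
move=> mf f01; apply: (@integrable_normal_poly R _ 1) => // x.
have /andP[f0 f1] := f01 x.
by rewrite ger0_norm// mul1r (le_trans f1)// lerDl exprn_ge0.
Qed.

Definition quad_incr a b y : R := a * (y ^+ 2 - mu2 R) + 2 * b * y.

Lemma continuous_quad_incr a b : continuous (quad_incr a b).
Proof.
move=> y; apply: (@cvgD _ R^o); apply: cvgM; try exact: cvg_cst; last exact: cvg_id.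
apply: (@cvgB _ R^o); last exact: cvg_cst.
exact: exprn_continuous.
Qed.

Lemma measurable_quad_incr a b : measurable_fun setT (quad_incr a b).
Proof. by apply: continuous_measurable_fun; exact: continuous_quad_incr. Qed.

Lemma integrable_center : L1 (fun y => y ^+ 2 - mu2 R).
Proof.
apply: (@integrable_EFinD (fun y => y ^+ 2) (fun=> - mu2 R)).
  exact: integrable_normal_exp.
have := @integrable_EFinZ _ (- mu2 R) (@integrable_normal_exp 0 isT).
by apply: eq_integrable => // y _; rewrite /= expr0 mulr1.
Qed.

Lemma integrable_quad_incr a b : L1 (quad_incr a b).
Proof.
apply: (@integrable_EFinD (fun y => a * (y ^+ 2 - mu2 R)) (fun y => 2 * b * y)).
  exact/integrable_EFinZ/integrable_center.
by apply: (@integrable_EFinZ (fun y => y)); exact: (@integrable_normal_exp 1 isT).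
Qed.

Lemma quad_incr_mean a b : \int[gamma]_y quad_incr a b y = 0.
Proof.
have I1 : L1 (fun y : R => y) by exact: (@integrable_normal_exp 1 isT).
have I2 : L1 (fun y : R => y ^+ 2) by exact: integrable_normal_exp.
have y0 : \int[gamma]_y y = 0.
  apply: (@Rintegral_normal_odd R (fun y => y) 1) => [y|//|y]; first exact: cvg_id.
  by rewrite mul1r -[leLHS]expr1 norm_exp_le6.
have I0 : L1 (fun=> mu2 R).
  have := @integrable_EFinZ _ (mu2 R) (@integrable_normal_exp 0 isT).
  by apply: eq_integrable => // y _; rewrite /= expr0 mulr1.
have E1 : \int[gamma]_y (y ^+ 2 - mu2 R) = 0.
  transitivity (\int[gamma]_y (y ^+ 2) - \int[gamma]_(y in setT) (mu2 R)).
    exact: (RintegralB measurableT I2 I0).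
  by rewrite Rintegral_normal_cst -/(mu2 R) subrr.
transitivity (\int[gamma]_y (a * (y ^+ 2 - mu2 R)) + \int[gamma]_y (2 * b * y)).
  apply: (RintegralD measurableT).
  - exact: (integrable_EFinZ a integrable_center).
  - exact: (integrable_EFinZ (2 * b) I1).
have -> : \int[gamma]_y (a * (y ^+ 2 - mu2 R)) = a * \int[gamma]_y (y ^+ 2 - mu2 R).
  exact: (RintegralZl a measurableT integrable_center).
have -> : \int[gamma]_y (2 * b * y) = 2 * b * \int[gamma]_y y.
  exact: (RintegralZl (2 * b) measurableT I1).
by rewrite E1 y0 !mulr0 addr0.
Qed.

(** The variance of [quad_incr a b] under the normal law: the cross term in [a * b] vanishes by
    oddness. *)
Definition quad_var a b : R := tau R * a ^+ 2 + 4 * mu2 R * b ^+ 2.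

Lemma quad_var_ge0 a b : 0 <= quad_var a b.
Proof.
rewrite /quad_var addr_ge0//.
  by rewrite mulr_ge0 ?sqr_ge0// ltW// tau_gt0.
by rewrite mulr_ge0 ?sqr_ge0// mulr_ge0 ?ler0n// mu2_ge0.
Qed.

Lemma integrable_odd_cross : L1 (fun y => y * (y ^+ 2 - mu2 R)) /\
  \int[gamma]_y (y * (y ^+ 2 - mu2 R)) = 0.
Proof.
have bd y : `|y * (y ^+ 2 - mu2 R)| <= (1 + mu2 R) * (1 + `|y| ^+ 6).
  have -> : y * (y ^+ 2 - mu2 R) = y ^+ 3 - mu2 R * y by ring.
  apply: le_trans (ler_normB _ _) _; rewrite mulrDl mul1r lerD//.
    by rewrite normrX norm_exp_le6.
  rewrite normrM (ger0_norm (mu2_ge0 R)); apply: ler_wpM2l; first exact: mu2_ge0.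
  by rewrite -[leLHS]expr1 norm_exp_le6.
have ct : continuous (fun y : R => y * (y ^+ 2 - mu2 R)).
  move=> y; apply: cvgM; first exact: cvg_id.
  apply: (@cvgB _ R^o); last exact: cvg_cst.
  exact: exprn_continuous.
split; first exact: integrable_normal_poly (continuous_measurable_fun ct) bd.
apply: Rintegral_normal_odd ct _ bd.
by move=> y; rewrite sqrrN mulNr.
Qed.

Lemma quad_incr_sqr a b : L1 (fun y => quad_incr a b y ^+ 2) /\
  \int[gamma]_y (quad_incr a b y ^+ 2) = quad_var a b.
Proof.
have [Ix Ex] := integrable_odd_cross.
have Ic := integrable_sqr_center R.
have I2 : L1 (fun y : R => y ^+ 2) by exact: integrable_normal_exp.
have J1 : L1 (fun y => a ^+ 2 * (y ^+ 2 - mu2 R) ^+ 2) by exact: integrable_EFinZ.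
have J2 : L1 (fun y => 4 * a * b * (y * (y ^+ 2 - mu2 R))) by exact: integrable_EFinZ.
have J3 : L1 (fun y => 4 * b ^+ 2 * y ^+ 2) by exact: integrable_EFinZ.
have J12 := integrable_EFinD J1 J2.
have E y : quad_incr a b y ^+ 2 = a ^+ 2 * (y ^+ 2 - mu2 R) ^+ 2
   + 4 * a * b * (y * (y ^+ 2 - mu2 R)) + 4 * b ^+ 2 * y ^+ 2.
  by rewrite /quad_incr; ring.
have -> : (fun y => quad_incr a b y ^+ 2) = (fun y => a ^+ 2 * (y ^+ 2 - mu2 R) ^+ 2
   + 4 * a * b * (y * (y ^+ 2 - mu2 R)) + 4 * b ^+ 2 * y ^+ 2).
  by apply/funext => y; exact: E.
split; first exact: (integrable_EFinD J12 J3).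
transitivity (\int[gamma]_y (a ^+ 2 * (y ^+ 2 - mu2 R) ^+ 2)
   + \int[gamma]_y (4 * a * b * (y * (y ^+ 2 - mu2 R))) + \int[gamma]_y (4 * b ^+ 2 * y ^+ 2)).
  rewrite -(RintegralD measurableT J1 J2); exact: (RintegralD measurableT J12 J3).
have -> : \int[gamma]_y (a ^+ 2 * (y ^+ 2 - mu2 R) ^+ 2) = a ^+ 2 * tau R.
  exact: (RintegralZl (a ^+ 2) measurableT Ic).
have -> : \int[gamma]_y (4 * a * b * (y * (y ^+ 2 - mu2 R))) = 4 * a * b * 0.
  transitivity (4 * a * b * \int[gamma]_y (y * (y ^+ 2 - mu2 R))); last by rewrite Ex.
  exact: (RintegralZl (4 * a * b) measurableT Ix).
have -> : \int[gamma]_y (4 * b ^+ 2 * y ^+ 2) = 4 * b ^+ 2 * mu2 R.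
  exact: (RintegralZl (4 * b ^+ 2) measurableT I2).
by rewrite /quad_var; ring.
Qed.

(** Only one of the three factors is estimated by [e]; the other two keep [a^2 + b^2] by the
    Cauchy-Schwarz inequality. The bound therefore stays summable over the coefficients with total
    small in [e]. *)
Lemma quad_incr_cube : exists2 M : R, 0 <= M & forall a b e,
  `|a| <= e -> `|b| <= e ->
  L1 (fun y => `|quad_incr a b y| ^+ 3) /\
  \int[gamma]_y (`|quad_incr a b y| ^+ 3) <= M * (e * (a ^+ 2 + b ^+ 2)).
Proof.
pose f (y : R) : R := (`|y ^+ 2 - mu2 R| + 2 * `|y|) ^+ 3.
have mf : measurable_fun setT f.
  apply: measurable_funX; apply: measurable_funD.
    apply: measurableT_comp => //; apply: measurable_funB => //; exact: measurable_funX.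
  by apply: measurable_funM => //; exact: normr_measurable.
have If : L1 f.
  apply: (@integrable_normal_poly R _ (32 + 4 * (mu2 R + 1) ^+ 3)) => // y.
  rewrite ger0_norm; last by rewrite exprn_ge0// addr_ge0// mulr_ge0.
  have m0 := mu2_ge0 R; have t0 := normr_ge0 y.
  have fy : `|y ^+ 2 - mu2 R| + 2 * `|y| <= 2 * `|y| ^+ 2 + (mu2 R + 1).
    have : `|y ^+ 2 - mu2 R| <= `|y| ^+ 2 + mu2 R.
      by apply: le_trans (ler_normB _ _) _; rewrite normrX (ger0_norm m0).
    have := sqr_ge0 (`|y| - 1); nra.
  apply: le_trans (_ : (2 * `|y| ^+ 2 + (mu2 R + 1)) ^+ 3 <= _).
    by rewrite lerXn2r ?nnegrE// ?addr_ge0 ?mulr_ge0 ?exprn_ge0.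
  have -> : `|y| ^+ 6 = (`|y| ^+ 2) ^+ 3 by rewrite -exprM.
  have : 0 <= `|y| ^+ 2 by exact: exprn_ge0.
  set u := `|y| ^+ 2 => u0; set v := mu2 R + 1.
  have v0 : 0 <= v by rewrite /v addr_ge0.
  have H1 : (2 * u + v) ^+ 3 <= 4 * ((2 * u) ^+ 3 + v ^+ 3).
    have : 0 <= (2 * u + v) * (2 * u - v) ^+ 2.
      by rewrite mulr_ge0 ?sqr_ge0// addr_ge0// mulr_ge0.
    lra.
  have : 0 <= v ^+ 3 * u ^+ 3 by rewrite mulr_ge0 ?exprn_ge0.
  lra.
have M0 : 0 <= \int[gamma]_y f y.
  by apply: Rintegral_ge0 => y _; rewrite /f exprn_ge0// addr_ge0// mulr_ge0.
exists (\int[gamma]_y f y) => // a b e ae be.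
have e0 : 0 <= e by apply: le_trans ae.
have pt y : `|quad_incr a b y| ^+ 3 <= e * (a ^+ 2 + b ^+ 2) * f y.
  rewrite /f; set p := `|y ^+ 2 - mu2 R|; set q := 2 * `|y|.
  have p0 : 0 <= p by exact: normr_ge0.
  have q0 : 0 <= q by rewrite mulr_ge0.
  have -> : a ^+ 2 = `|a| ^+ 2 by rewrite -normrX ger0_norm// sqr_ge0.
  have -> : b ^+ 2 = `|b| ^+ 2 by rewrite -normrX ger0_norm// sqr_ge0.
  have a0 := normr_ge0 a; have b0 := normr_ge0 b.
  have le1 : `|quad_incr a b y| <= `|a| * p + `|b| * q.
    apply: le_trans (ler_normD _ _) _; rewrite !normrM lerD//.
    by rewrite (ger0_norm (_ : 0 <= 2))// /q; lra.
  apply: le_trans (_ : (`|a| * p + `|b| * q) ^+ 3 <= _).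
    by rewrite lerXn2r ?nnegrE// addr_ge0// mulr_ge0.
  set A := `|a| in ae a0 *; set B := `|b| in be b0 *.
  have s1 : A * p + B * q <= e * (p + q) by nra.
  have s2 : (A * p + B * q) ^+ 2 <= (A ^+ 2 + B ^+ 2) * (p + q) ^+ 2.
    have : 0 <= (A * q - B * p) ^+ 2 by exact: sqr_ge0.
    have : 0 <= (A ^+ 2 + B ^+ 2) * (2 * p * q).
      by rewrite mulr_ge0 ?addr_ge0 ?sqr_ge0// !mulr_ge0.
    lra.
  rewrite exprS.
  have -> : e * (A ^+ 2 + B ^+ 2) * (p + q) ^+ 3 =
    (e * (p + q)) * ((A ^+ 2 + B ^+ 2) * (p + q) ^+ 2) by ring.
  by apply: ler_pM => //; rewrite ?sqr_ge0// addr_ge0// mulr_ge0.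
have Ief := @integrable_EFinZ f (e * (a ^+ 2 + b ^+ 2)) If.
have I3 : L1 (fun y => `|quad_incr a b y| ^+ 3).
  apply: (@le_integrable _ _ _ gamma setT measurableT _ _ _ _ Ief).
    apply/measurable_EFinP; apply: measurable_funX; apply: measurableT_comp => //.
    exact: measurable_quad_incr.
  move=> y _ /=; rewrite lee_fin ger0_norm ?exprn_ge0//.
  exact: le_trans (pt y) (ler_norm _).
split => //.
rewrite [leRHS]mulrC -(RintegralZl (e * (a ^+ 2 + b ^+ 2)) measurableT If).
exact: (le_Rintegral measurableT I3 Ief).
Qed.

(** In the Taylor expansion the linear term integrates to 0 and the quadratic one to
    [- h / 2 * z * phi z], with [h] the variance of the increment. This is also the first-order term
    of [Phi_heat], so only the third moment and [h^2] remain. *)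
Lemma one_step : exists2 K : R, 0 < K & forall a b e z,
  e <= 1 -> `|a| <= e -> `|b| <= e -> quad_var a b <= 3 ->
  `|\int[gamma]_y Phi (z - quad_incr a b y) - Phi (z / Num.sqrt (1 + quad_var a b))|
    <= K * (e * (a ^+ 2 + b ^+ 2)).
Proof.
have [K1 K10 K1P] := Phi_taylor3 R.
have [K2 K20 K2P] := Phi_heat.
have [M M0 MP] := quad_incr_cube.
pose c := tau R + 4 * mu2 R.
have c0 : 0 < c by rewrite ltr_wpDr ?tau_gt0// mulr_ge0 ?mu2_ge0.
exists (K1 * M + K2 * (c ^+ 2 * 2)).
  by rewrite ltr_wpDl ?mulr_gt0 ?exprn_gt0// mulr_ge0// ltW.
move=> a b e z e1 ae be h3.
have e0 : 0 <= e by apply: le_trans ae.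
have [I3 M3] := MP a b e ae be.
have I1 := integrable_quad_incr a b.
have [I2 E2] := quad_incr_sqr a b.
set h := quad_var a b in h3 E2 *.
have h0 : 0 <= h by exact: quad_var_ge0.
have a2 : a ^+ 2 <= e ^+ 2 by rewrite -real_normK ?num_real// lerXn2r ?nnegrE.
have b2 : b ^+ 2 <= e ^+ 2 by rewrite -real_normK ?num_real// lerXn2r ?nnegrE.
have hc : h <= c * (a ^+ 2 + b ^+ 2).
  rewrite /h /quad_var /c; have := sqr_ge0 a; have := sqr_ge0 b.
  by have := tau_gt0 R; have := mu2_ge0 R; nra.
have ab0 : 0 <= a ^+ 2 + b ^+ 2 by rewrite addr_ge0 ?sqr_ge0.
(* One factor [a^2 + b^2] is at most [2 * e^2 <= 2 * e], as [e <= 1]; this gives [h^2] the same form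
   as the third-moment term. *)
have h2 : h ^+ 2 <= c ^+ 2 * 2 * (e * (a ^+ 2 + b ^+ 2)).
  apply: le_trans (_ : (c * (a ^+ 2 + b ^+ 2)) ^+ 2 <= _).
    by rewrite lerXn2r ?nnegrE// mulr_ge0// ltW.
  have : a ^+ 2 + b ^+ 2 <= 2 * e by nra.
  move: ab0; set s := a ^+ 2 + b ^+ 2 => s0 s2.
  have -> : (c * s) ^+ 2 = c ^+ 2 * (s * s) by ring.
  have -> : c ^+ 2 * 2 * (e * s) = c ^+ 2 * (2 * e * s) by ring.
  by apply: ler_wpM2l; [exact: sqr_ge0|exact: ler_wpM2r].
pose g y := Phi (z - quad_incr a b y).
have mg : measurable_fun setT g.
  apply: measurableT_comp; first exact: measurable_Phi.
  by apply: measurable_funB => //; exact: measurable_quad_incr.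
have Ig : L1 g by apply: integrable_bounded1 => // y; rewrite Phi_ge0 Phi_le1.
have Ic : L1 (fun=> - Phi z).
  have := @integrable_EFinZ _ (- Phi z) (@integrable_normal_exp 0 isT).
  by apply: eq_integrable => // y _; rewrite /= expr0 mulr1.
have J1 := @integrable_EFinZ _ (phi z) I1.
have J2 := @integrable_EFinZ _ (z * phi z / 2) I2.
have Jgc := integrable_EFinD Ig Ic.
have Jgc1 := integrable_EFinD Jgc J1.
have J := integrable_EFinD Jgc1 J2.
have EJ : \int[gamma]_y (g y + - Phi z + phi z * quad_incr a b y
    + z * phi z / 2 * quad_incr a b y ^+ 2) =
   \int[gamma]_y g y - Phi z + h / 2 * (z * phi z).
  transitivity (\int[gamma]_y g y + \int[gamma]_(y in setT) (- Phi z)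
      + \int[gamma]_y (phi z * quad_incr a b y)
      + \int[gamma]_y (z * phi z / 2 * quad_incr a b y ^+ 2)).
    rewrite -(RintegralD measurableT Ig Ic) -(RintegralD measurableT Jgc J1).
    exact: (RintegralD measurableT Jgc1 J2).
  have -> : \int[gamma]_y (phi z * quad_incr a b y) = phi z * 0.
    rewrite -[X in _ = _ * X](quad_incr_mean a b).
    exact: (RintegralZl (phi z) measurableT I1).
  have -> : \int[gamma]_y (z * phi z / 2 * quad_incr a b y ^+ 2) = z * phi z / 2 * h.
    by rewrite -E2; exact: (RintegralZl (z * phi z / 2) measurableT I2).
  rewrite Rintegral_normal_cst; ring.
have B1 : `|\int[gamma]_y g y - Phi z + h / 2 * (z * phi z)|
    <= K1 * (M * (e * (a ^+ 2 + b ^+ 2))).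
  rewrite -EJ; apply: le_trans (le_normr_Rintegral measurableT J) _.
  apply: le_trans (_ : \int[gamma]_y (K1 * `|quad_incr a b y| ^+ 3) <= _).
    apply: le_Rintegral => //.
    - exact: (integrable_abse J).
    - exact: integrable_EFinZ I3.
    move=> y _; have := K1P z (- quad_incr a b y).
    rewrite normrN sqrrN /g.
    by apply: le_trans; rewrite le_eqVlt; apply/orP; left; apply/eqP; congr `|_|; ring.
  have -> : \int[gamma]_y (K1 * `|quad_incr a b y| ^+ 3) = K1 * \int[gamma]_y (`|quad_incr a b y| ^+ 3).
    exact: (RintegralZl K1 measurableT I3).
  by rewrite ler_pM2l.
have B2 := K2P z h; rewrite h0 h3 in B2; have {}B2 := B2 isT.
have -> : \int[gamma]_y g y - Phi (z / Num.sqrt (1 + h)) =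
  (\int[gamma]_y g y - Phi z + h / 2 * (z * phi z))
  - (Phi (z / Num.sqrt (1 + h)) - Phi z + h / 2 * (z * phi z)) by ring.
apply: le_trans (ler_normB _ _) _; rewrite [leRHS]mulrDl lerD//.
  by rewrite -[leRHS]mulrA.
apply: le_trans B2 _; rewrite -[leRHS]mulrA ler_pM2l//.
Qed.

End OneStep.

(** * Independence *)

(** Rectangles form a pi-system generating the product sigma-algebra. The measures compared need not
    be products: they will be laws of pairs, possibly restricted to an event. *)
Lemma rectangle_measure_unique (d1 d2 : measure_display) (T1 : measurableType d1)
    (T2 : measurableType d2) (R : realType)
    (m1 m2 : {measure set (T1 * T2)%type -> \bar R}) :
  (m1 setT < +oo)%E ->
  (forall A B, measurable A -> measurable B -> m1 (A `*` B) = m2 (A `*` B)) ->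
  forall S, measurable S -> m1 S = m2 S.
Proof.
move=> fin1 rect S mS.
pose G : set (set (T1 * T2)) :=
  [set C | exists A, measurable A /\ exists B, measurable B /\ C = A `*` B].
apply: (measure_unique G (fun=> setT)) => //.
- rewrite measurable_prod_measurableType //; congr (<<s _ >>).
  rewrite predeqE; split => [[A mA [B mB <-]]|[A [mA [B [mB ->]]]]].
    by exists A; split => //; exists B.
  by exists A => //; exists B.
- move=> /= _ _ [X1 [mX1 [X2 [mX2 ->]]]] [Y1 [mY1 [Y2 [mY2 ->]]]].
  rewrite -setXI; exists (X1 `&` Y1); split; first exact: measurableI.
  by exists (X2 `&` Y2); split => //; exact: measurableI.
- by move=> i; exists setT; split => //; exists setT; split; rewrite ?setXTT.
- by rewrite bigcup_const.
- by move=> A [A1 [mA1 [A2 [mA2 ->]]]]; exact: rect.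
Qed.

Section Independence.
Context (d : measure_display) (T : measurableType d) (R : realType).
Variables (P : probability T R) (xi : nat -> {RV P >-> R}).
Hypothesis xi_iid : iid_std_normal xi.

Definition later (s : seq nat) (B : nat -> set R) : set T :=
  \big[setI/setT]_(i <- s) (xi i @^-1` B i).

(** Independence of [X] from the variables of index at least [N], tested on finite cylinder events:
    exactly what the product formula of [iid_std_normal] can feed, and a form that survives the
    adjunction of [xi N] to [X]. *)
Definition indep_future (N : nat) (X : T -> R) := forall A s B,
  measurable A -> uniq s -> (forall i, i \in s -> (N <= i)%N) ->
  (forall i, measurable (B i)) ->
  P (X @^-1` A `&` later s B) = (P (X @^-1` A) * P (later s B))%E.

Lemma measurable_preimage_xi i (B : set R) : measurable B -> measurable (xi i @^-1` B).
Proof. by move=> mB; rewrite -[_ @^-1` _]setTI; exact: (measurable_funP (xi i)). Qed.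

Lemma measurable_later s B : (forall i, measurable (B i)) -> measurable (later s B).
Proof.
by move=> mB; apply: big_ind => // [A C|i _]; [exact: measurableI|exact: measurable_preimage_xi].
Qed.

Lemma prob_later_cons N s B : uniq (N :: s) -> (forall i, measurable (B i)) ->
  P (later (N :: s) B) = (P (xi N @^-1` B N) * P (later s B))%E.
Proof.
move=> us mB; have [_ ind] := xi_iid.
rewrite /later ind// big_cons; congr (_ * _)%E; rewrite ind//.
by move: us => /= /andP[].
Qed.

Lemma indep_future_rect N X A1 A2 s B : indep_future N X ->
  measurable A1 -> measurable A2 -> uniq s -> (forall i, i \in s -> (N < i)%N) ->
  (forall i, measurable (B i)) ->
  P (X @^-1` A1 `&` (xi N @^-1` A2 `&` later s B)) =
  (P (X @^-1` A1) * (P (xi N @^-1` A2) * P (later s B)))%E.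
Proof.
move=> iX mA1 mA2 us sN mB.
(* The hypothesis takes a single family of sets, so [A2] is inserted at index [N]; this leaves
   [later s B] unchanged since [N] is not in [s]. *)
pose B' i := if i == N then A2 else B i.
have mB' i : measurable (B' i) by rewrite /B'; case: ifP.
have Ns : N \notin s by apply/negP => /sN; rewrite ltnn.
have lE : later s B = later s B'.
  rewrite /later; apply: eq_big_seq => i is_.
  by rewrite /B'; case: eqP => // iN; move: is_; rewrite iN (negbTE Ns).
have uNs : uniq (N :: s) by rewrite /= Ns.
have {1 2}-> : A2 = B' N by rewrite /B' eqxx.
rewrite lE -prob_later_cons//.
have -> : xi N @^-1` B' N `&` later s B' = later (N :: s) B' by rewrite /later big_cons.
apply: iX => // i; rewrite inE => /orP[/eqP->//|/sN/ltnW//].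
Qed.

(** With the later event fixed, two finite measures on the plane are compared: the law of
    [(X, xi N)] restricted to that event, and the unrestricted law multiplied by the probability of
    the event. They agree on rectangles, hence on the preimage of [A] under [G]. *)
Lemma indep_future_step N (X : T -> R) (G : R * R -> R) :
  measurable_fun setT X -> measurable_fun setT G -> indep_future N X ->
  indep_future N.+1 (fun om => G (X om, xi N om)).
Proof.
move=> mX mG iX A s B mA us sN mB.
pose pr om := (X om, xi N om).
have mpr : measurable_fun setT pr by apply/measurable_fun_pairP.
have mE := measurable_later s mB.
pose prM : {mfun T >-> (R * R)%type} := HB.pack pr (isMeasurableFun.Build _ _ _ _ _ mpr).
have PEfin : P (later s B) \is a fin_num by exact: fin_num_measure.
have c0 : 0 <= fine (P (later s B)) by exact: fine_ge0.
pose m10 : {measure set (R * R)%type -> \bar R} := pushforward (mrestr P mE) prM.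
pose m1 := m10 mpr.
pose m2 : {measure set (R * R)%type -> \bar R} := mscale (NngNum c0) (distribution P prM).
have mGA : measurable (G @^-1` A) by rewrite -[_ @^-1` _]setTI; exact: mG.
have m12 : m1 (G @^-1` A) = m2 (G @^-1` A).
  apply: rectangle_measure_unique => //.
    rewrite /m1 /m10 /= /pushforward /mrestr preimage_setT setTI.
    by rewrite -ge0_fin_numE.
  move=> A1 A2 mA1 mA2; rewrite /m1 /m10 /m2 /= /mscale /distribution /mrestr /pushforward /= fineK//.
  have prE : prM @^-1` (A1 `*` A2) = X @^-1` A1 `&` xi N @^-1` A2 by [].
  rewrite prE -setIA indep_future_rect//.
  have := @indep_future_rect N X A1 A2 [::] (fun=> setT) iX mA1 mA2 isT.
  rewrite /later big_nil setIT probability_setT mule1 => H1.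
  have -> : distribution P prM (A1 `*` A2) = P (X @^-1` A1 `&` xi N @^-1` A2) by [].
  by rewrite H1// muleA muleC.
have -> : P ((fun om => G (X om, xi N om)) @^-1` A `&` later s B) = m1 (G @^-1` A) by [].
by rewrite m12 /m2 /= /mscale /distribution /pushforward /= fineK// muleC.
Qed.

(* The Borel structures on [R] and on [measurableTypeR R] carry different
   displays, so the law of [xi N] is transported through a repackaged copy of
   [xi N]. *)
Lemma integral_xi N (f : R -> R) : measurable_fun setT f -> (forall y, 0 <= f y) ->
  (\int[distribution P (xi N)]_y (f y)%:E = \int[normal_prob 0 1]_y (f y)%:E)%E.
Proof.
move=> mf f0.
have mfE : measurable_fun setT (EFin \o f) by exact/measurable_EFinP.
have f0E y : (0 <= (EFin \o f) y)%E by rewrite lee_fin.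
rewrite (@ge0_integral_distribution _ _ _ _ _ P (xi N) (EFin \o f) mfE f0E).
have mxi : measurable_fun setT (xi N : T -> measurableTypeR R).
  exact: (measurable_funP (xi N)).
pose xi' : {RV P >-> measurableTypeR R} :=
  HB.pack (xi N : T -> measurableTypeR R) (isMeasurableFun.Build _ _ _ _ _ mxi).
rewrite -(@ge0_integral_distribution _ _ _ _ _ P xi' (EFin \o f) mfE f0E).
apply: eq_measure_integral => A mA _.
by have [law _] := xi_iid; exact: law.
Qed.

(** Independence makes the law of [(X, xi N)] the product of the two laws, after which Tonelli
    integrates [xi N] out with [X] held fixed. *)
Lemma tonelli_indep N (X : T -> R) (H : R * R -> R) :
  measurable_fun setT X -> indep_future N X ->
  measurable_fun setT H -> (forall z, 0 <= H z) ->
  (\int[P]_om (H (X om, xi N om))%:E =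
   \int[P]_om \int[normal_prob 0 1]_y (H (X om, y))%:E)%E /\
  measurable_fun setT (fun om => \int[normal_prob 0 1]_y (H (X om, y))%:E)%E.
Proof.
move=> mX iX mH H0.
pose pr om := (X om, xi N om).
have mpr : measurable_fun setT pr by apply/measurable_fun_pairP.
pose prM : {mfun T >-> (R * R)%type} := HB.pack pr (isMeasurableFun.Build _ _ _ _ _ mpr).
pose XM : {RV P >-> R} := HB.pack X (isMeasurableFun.Build _ _ _ _ _ mX).
pose m1 : probability R R := distribution P XM.
pose m2 : probability R R := distribution P (xi N).
have mHE : measurable_fun setT (EFin \o H) by exact/measurable_EFinP.
have H0E z : (0 <= (EFin \o H) z)%E by rewrite lee_fin.
have E1 : (\int[P]_om (H (X om, xi N om))%:E = \int[distribution P prM]_z (EFin \o H) z)%E.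
  by rewrite (@ge0_integral_distribution _ _ _ _ _ P prM (EFin \o H) mHE H0E).
have E2 : (\int[distribution P prM]_z (EFin \o H) z = \int[m1 \x m2]_z (EFin \o H) z)%E.
  apply: eq_measure_integral => S mS _.
  apply/esym; apply: product_measure_unique => // A B mA mB.
  have := @indep_future_rect N X A B [::] (fun=> setT) iX mA mB isT.
  by rewrite /later big_nil setIT probability_setT mule1 => H1; exact: H1.
have FE om : fubini_F m2 (EFin \o H) (X om) = (\int[normal_prob 0 1]_y (H (X om, y))%:E)%E.
  rewrite -(@integral_xi N (fun y => H (X om, y)))//.
  by apply: measurableT_comp => //; exact: pair1_measurable.
have mF : measurable_fun setT (fubini_F m2 (EFin \o H)).
  exact: measurable_fun_fubini_tonelli_F.
split.
  rewrite E1 E2 fubini_tonelli1// /m1 ge0_integral_distribution//.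
    by apply: eq_integral => om _; rewrite /= FE.
  by move=> x; apply: integral_ge0.
have -> : (fun om => \int[normal_prob 0 1]_y (H (X om, y))%:E)%E =
    fubini_F m2 (EFin \o H) \o X by apply/funext => om /=; rewrite FE.
exact: measurableT_comp.
Qed.

Variable g : nat -> R -> R.
Hypothesis mg : forall j, measurable_fun setT (g j).

Definition psumRV N (om : T) : R := \sum_(1 <= j < N) g j (xi j om).

Lemma measurable_psumRV N : measurable_fun setT (psumRV N).
Proof. by apply: measurable_sum => j; apply: measurableT_comp. Qed.

Lemma psumRV_indep N : indep_future N (psumRV N).
Proof.
elim: N => [|N IH].
  move=> A s B mA us sN mB; rewrite /psumRV.
  have [A0|nA0] := pselect (A 0).
  - rewrite (_ : _ @^-1` A = setT) ?setTI ?probability_setT ?mul1e//.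
    by apply/seteqP; split => // om _ /=; rewrite big_geq.
  - rewrite (_ : _ @^-1` A = set0) ?set0I ?measure0 ?mul0e//.
    by apply/seteqP; split => // om /=; rewrite big_geq.
(* Sums start at index 1, so [psumRV 1] is still empty and cannot be split off by [big_nat_recr]. *)
have [->|N0] := posnP N.
  move=> A s B mA us sN mB; rewrite /psumRV.
  have [A0|nA0] := pselect (A 0).
  - rewrite (_ : _ @^-1` A = setT) ?setTI ?probability_setT ?mul1e//.
    by apply/seteqP; split => // om _ /=; rewrite big_geq.
  - rewrite (_ : _ @^-1` A = set0) ?set0I ?measure0 ?mul0e//.
    by apply/seteqP; split => // om /=; rewrite big_geq.
have -> : psumRV N.+1 = fun om => (fun z : R * R => z.1 + g N z.2) (psumRV N om, xi N om).
  by apply/funext => om; rewrite /psumRV big_nat_recr.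
apply: (@indep_future_step N (psumRV N) (fun z : R * R => z.1 + g N z.2)) => //.
  exact: measurable_psumRV.
by apply: measurable_funD => //; apply: measurableT_comp.
Qed.

End Independence.

(** * Lindeberg replacement *)

Section Lindeberg.
Context (d : measure_display) (T : measurableType d) (R : realType).
Variables (P : probability T R) (xi : nat -> {RV P >-> R}).
Hypothesis xi_iid : iid_std_normal xi.
Implicit Types (a b : nat -> R) (e m v x K : R) (N : nat).

Local Notation gamma := (@normal_prob R 0 1).

Lemma integrable_bounded (f : T -> R) K : measurable_fun setT f ->
  (forall om, `|f om| <= K) -> P.-integrable setT (EFin \o f).
Proof.
move=> mf fK.
apply: (@le_integrable _ _ _ P setT measurableT (EFin \o f) (fun=> K%:E)).
- exact/measurable_EFinP.
- by move=> om _; rewrite /= lee_fin; exact: le_trans (fK om) (ler_norm _).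
- exact: finite_measure_integrable_cst.
Qed.

Lemma Rintegral_prob_cst K : \int[P]_(_ in setT) K = K.
Proof. by rewrite Rintegral_cst//= probability_setT/= mulr1. Qed.

Definition qform a b N (om : T) : R :=
  psumRV xi (fun j => quad_incr (a j) (b j)) N om.

Definition vsum a b N : R := \sum_(1 <= j < N) quad_var (a j) (b j).

Definition qsum a b N : R := \sum_(1 <= j < N) (a j ^+ 2 + b j ^+ 2).

Lemma measurable_qform a b N : measurable_fun setT (qform a b N).
Proof. by apply: measurable_psumRV => j; exact: measurable_quad_incr. Qed.

Lemma quad_incrZ c (a b y : R) : quad_incr (c * a) (c * b) y = c * quad_incr a b y.
Proof. by rewrite /quad_incr; ring. Qed.

Lemma quad_varZ c (a b : R) : quad_var (c * a) (c * b) = c ^+ 2 * quad_var a b.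
Proof. by rewrite /quad_var; ring. Qed.

(** Dividing by [sqrt v] reduces to [one_step]. As [v >= 1] this only shrinks the coefficients, so
    [e] serves for every [v]. *)
Lemma lindeberg_step : exists2 K : R, 0 < K & forall a b e v m N,
  1 <= v -> e <= 1 -> `|a N| <= e -> `|b N| <= e -> quad_var (a N) (b N) <= 3 ->
  (0 < N)%N ->
  `|\int[P]_om Phi ((m - qform a b N.+1 om) / Num.sqrt v)
    - \int[P]_om Phi ((m - qform a b N om) / Num.sqrt (v + quad_var (a N) (b N)))|
  <= K * (e * (a N ^+ 2 + b N ^+ 2)).
Proof.
have [K K0 KP] := one_step R.
exists K => // a b e v m N v1 e1 ae be h3 N0.
have e0 : 0 <= e by apply: le_trans ae.
have v0 : 0 < v by lra.
set s := Num.sqrt v.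
have s1 : 1 <= s by rewrite -[leLHS]sqrtr1 /s ler_sqrt// ltW.
have s0 : 0 < s by lra.
have s2 : s ^+ 2 = v by rewrite sqr_sqrtr// ltW.
have si0 : 0 <= s^-1 by rewrite invr_ge0 ltW.
have si1 : s^-1 <= 1 by rewrite invf_le1.
have shrink (t : R) : `|t| <= e -> `|s^-1 * t| <= e.
  move=> te; rewrite normrM (ger0_norm si0); apply: le_trans te.
  by rewrite ler_piMl.
have shrink2 (t : R) : (s^-1 * t) ^+ 2 <= t ^+ 2.
  by rewrite exprMn ler_piMl ?sqr_ge0// exprn_ile1.
have hE : quad_var (s^-1 * a N) (s^-1 * b N) = quad_var (a N) (b N) / v.
  by rewrite quad_varZ exprVn s2 mulrC.
set h := quad_var (a N) (b N) in h3 hE *.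
have h0 : 0 <= h by exact: quad_var_ge0.
have hv3 : h / v <= 3.
  by rewrite ler_pdivrMr//; apply: le_trans h3 _; rewrite ler_peMr.
(* First coordinate the past sum, second the summand to be replaced: [one_step] is applied for each
   fixed value of the past. *)
pose H (z : R * R) := Phi ((m - z.1 - quad_incr (a N) (b N) z.2) / s).
have mH : measurable_fun setT H.
  apply: measurableT_comp; first exact: measurable_Phi.
  apply: measurable_funM => //; apply: measurable_funB.
    exact: measurable_funB.
  by apply: measurableT_comp => //; exact: measurable_quad_incr.
have HE om : H (qform a b N om, xi N om) = Phi ((m - qform a b N.+1 om) / s).
  have -> : qform a b N.+1 om = qform a b N om + quad_incr (a N) (b N) (xi N om).
    by rewrite /qform /psumRV big_nat_recr.
  have E (q t : R) : m - (q + t) = m - q - t by rewrite opprD addrA.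
  by rewrite E.
have H0 z : 0 <= H z by exact: Phi_ge0.
have mZ := measurable_qform a b N.
have indZ : indep_future xi N (qform a b N).
  by apply: psumRV_indep => // j; exact: measurable_quad_incr.
have [tonelli mInner] := tonelli_indep xi_iid mZ indZ mH H0.
pose G om := \int[gamma]_y H (qform a b N om, y).
have GE om : (\int[gamma]_y (H (qform a b N om, y))%:E)%E = (G om)%:E.
  rewrite /G /Rintegral fineK//; apply: integrable_fin_num => //.
  apply: (@integrable_bounded1 R (fun y => H (qform a b N om, y))).
    by apply: measurableT_comp => //; exact: pair1_measurable.
  by move=> y; rewrite Phi_ge0 Phi_le1.
have mG : measurable_fun setT G.
  apply/measurable_EFinP; rewrite (_ : EFin \o G =
    (fun om => \int[gamma]_y (H (qform a b N om, y))%:E)%E)//.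
  by apply/funext => om; rewrite GE.
have E1 : \int[P]_om Phi ((m - qform a b N.+1 om) / s) = \int[P]_om G om.
  rewrite /Rintegral; congr fine.
  transitivity (\int[P]_om (H (qform a b N om, xi N om))%:E)%E.
    by apply: eq_integral => om _; rewrite HE.
  by rewrite tonelli; apply: eq_integral => om _; rewrite GE.
pose F om := Phi ((m - qform a b N om) / Num.sqrt (v + h)).
have mF : measurable_fun setT F.
  apply: measurableT_comp; first exact: measurable_Phi.
  by apply: measurable_funM => //; apply: measurable_funB.
have GF om : `|G om - F om| <= K * (e * (a N ^+ 2 + b N ^+ 2)).
  have := KP (s^-1 * a N) (s^-1 * b N) e ((m - qform a b N om) / s) e1
    (shrink _ ae) (shrink _ be).
  rewrite hE => /(_ hv3).
  have -> : \int[gamma]_y Phi ((m - qform a b N om) / s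
       - quad_incr (s^-1 * a N) (s^-1 * b N) y) = G om.
    apply: eq_Rintegral => y _; rewrite quad_incrZ /H; congr Phi.
    by rewrite /= [RHS]mulrBl [_ * s^-1 in X in _ = _ - X]mulrC.
  have -> : (m - qform a b N om) / s / Num.sqrt (1 + h / v) =
      (m - qform a b N om) / Num.sqrt (v + h).
    rewrite -mulrA -invfM; congr (_ / _).
    rewrite /s -sqrtrM ?ltW//; congr Num.sqrt; field.
    by rewrite gt_eqF.
  move=> /le_trans; apply; rewrite ler_pM2l//; apply: ler_wpM2l => //.
  by rewrite lerD.
have IG : P.-integrable setT (EFin \o G).
  apply: (@integrable_bounded _ (1 + K * (e * (a N ^+ 2 + b N ^+ 2)))) => // om.
  have -> : G om = F om + (G om - F om) by ring.
  by apply: le_trans (ler_normD _ _) _; rewrite lerD// ger0_norm ?Phi_ge0 ?Phi_le1.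
have IF : P.-integrable setT (EFin \o F).
  by apply: (@integrable_bounded _ 1) => // om; rewrite ger0_norm ?Phi_ge0 ?Phi_le1.
have IGF : P.-integrable setT (EFin \o (fun om => G om - F om)).
  apply: (@integrable_bounded _ (K * (e * (a N ^+ 2 + b N ^+ 2)))) => //.
  exact: measurable_funB.
have E2 : \int[P]_om G om - \int[P]_om F om = \int[P]_om (G om - F om).
  exact: esym (RintegralB measurableT IG IF).
rewrite E1 {}E2.
apply: le_trans (le_normr_Rintegral measurableT IGF) _.
rewrite -[leRHS]Rintegral_prob_cst; apply: le_Rintegral => //.
- exact: (integrable_abse IGF).
- exact: finite_measure_integrable_cst.
Qed.

(** Replacing the last summand moves its variance into [v], so the induction on [N] runs with [v]
    arbitrary. *)
Lemma lindeberg : exists2 K : R, 0 < K & forall a b e N,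
  e <= 1 -> (forall j, (0 < j)%N -> `|a j| <= e) -> (forall j, (0 < j)%N -> `|b j| <= e) ->
  (forall j, (0 < j)%N -> quad_var (a j) (b j) <= 3) -> forall v m, 1 <= v ->
  `|\int[P]_om Phi ((m - qform a b N om) / Num.sqrt v)
     - Phi (m / Num.sqrt (v + vsum a b N))| <= K * (e * qsum a b N).
Proof.
have [K K0 KP] := lindeberg_step.
exists K => // a b e N e1 ae be h3.
have base n v m : (n <= 1)%N -> `|\int[P]_om Phi ((m - qform a b n om) / Num.sqrt v)
     - Phi (m / Num.sqrt (v + vsum a b n))| <= K * (e * qsum a b n).
  move=> n1; rewrite /vsum /qsum !big_geq// addr0 !mulr0.
  rewrite (@eq_Rintegral _ _ _ P setT (fun=> Phi (m / Num.sqrt v))).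
    by rewrite Rintegral_prob_cst subrr normr0.
  by move=> om _; rewrite /qform /psumRV big_geq// subr0.
elim: N => [|N IH] v m v1; first exact: base.
have [->|N0] := posnP N; first exact: base.
have h0 := quad_var_ge0 (a N) (b N).
have := IH (v + quad_var (a N) (b N)) m (ler_wpDr h0 v1).
have := KP a b e v m N v1 e1 (ae N N0) (be N N0) (h3 N N0) N0.
have -> : v + vsum a b N.+1 = v + quad_var (a N) (b N) + vsum a b N.
  by rewrite /vsum big_nat_recr//=; ring.
have -> : K * (e * qsum a b N.+1) = K * (e * (a N ^+ 2 + b N ^+ 2)) + K * (e * qsum a b N).
  by rewrite /qsum big_nat_recr//=; ring.
move=> B1 B2.
exact: le_trans (ler_distD _ _ _) (lerD B1 B2).
Qed.

Lemma indicator_integral (A : set T) (f : T -> R) (c : R) :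
  measurable A -> P.-integrable setT (EFin \o f) ->
  (forall om, f om <= \1_A om + c) -> \int[P]_om f om <= fine (P A) + c.
Proof.
move=> mA If fA.
have IA : P.-integrable setT (EFin \o (\1_A : T -> R)).
  by apply: (@integrable_bounded _ 1) => // om; rewrite indicE ger0_norm// lern1 leq_b1.
have Ic : P.-integrable setT (EFin \o (fun=> c : R)) by exact: finite_measure_integrable_cst.
have <- : \int[P]_om (\1_A om + c) = fine (P A) + c.
  rewrite (RintegralD measurableT IA Ic) Rintegral_prob_cst; congr (_ + _).
  by rewrite /Rintegral integral_indic// setIT.
apply: le_Rintegral => //; exact: (integrableD measurableT IA Ic).
Qed.

Lemma indicator_integral_ge (A : set T) (f : T -> R) (c : R) :
  measurable A -> P.-integrable setT (EFin \o f) ->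
  (forall om, \1_A om <= f om + c) -> fine (P A) <= \int[P]_om f om + c.
Proof.
move=> mA If fA.
have IA : P.-integrable setT (EFin \o (\1_A : T -> R)).
  by apply: (@integrable_bounded _ 1) => // om; rewrite indicE ger0_norm// lern1 leq_b1.
have Ic : P.-integrable setT (EFin \o (fun=> c : R)) by exact: finite_measure_integrable_cst.
have <- : \int[P]_om (\1_A om) = fine (P A).
  by rewrite /Rintegral integral_indic// setIT.
have <- : \int[P]_om (f om + c) = \int[P]_om f om + c.
  by rewrite (RintegralD measurableT If Ic) Rintegral_prob_cst.
apply: le_Rintegral => //; exact: (integrableD measurableT If Ic).
Qed.

End Lindeberg.

(** * Normal approximation of quadratic forms *)

Section CentralLimit.
Context (d : measure_display) (T : measurableType d) (R : realType).
Variables (P : probability T R) (xi : nat -> {RV P >-> R}).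
Hypothesis xi_iid : iid_std_normal xi.
Implicit Types (a b : nat -> R) (e m v x K : R) (N : nat).

Lemma Phi_homo : {homo @Phi R : x y / x <= y}.
Proof.
move=> x y xy; rewrite -lee_fin !PhiE; apply: le_measure; rewrite ?inE//.
exact: subset_itvl.
Qed.

Lemma phi_le_peak (z : R) : phi z <= normal_peak 1.
Proof. exact/normal_pdf_ub/oner_neq0. Qed.

Lemma Phi_lipschitz : exists2 L : R, 0 < L & forall x y : R, `|Phi y - Phi x| <= L * `|y - x|.
Proof.
exists (normal_peak 1); first by rewrite normal_peak_gt0 ?oner_neq0.
move=> x y; apply: (@mean_value_bound R (@Phi R) (@phi R)) => z _.
  exact: is_derive_Phi.
by rewrite ger0_norm ?phi_ge0// phi_le_peak.
Qed.

Lemma Phi_tails (eta : R) : 0 < eta ->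
  exists2 c : R, 0 < c & Phi (- c) <= eta /\ 1 - eta <= Phi c.
Proof.
move=> eta0.
(* The identity is a random variable under the normal law with distribution function [Phi]; the
   limits of distribution functions at both infinities then apply. *)
pose idm : measurableTypeR R -> R := idfun.
have mid : measurable_fun setT idm by move=> _ Y mY; rewrite setTI.
pose X : {RV (@normal_prob R 0 1 : probability (measurableTypeR R) R) >-> R} :=
  HB.pack idm (isMeasurableFun.Build _ _ _ _ idm mid).
have cE : cdf X = (fun x => (Phi x)%:E) by apply/funext => x; rewrite PhiE.
have := cvg_cdfy1 X; have := cvg_cdfNy0 X; rewrite cE => /fine_cvg c0 /fine_cvg c1.
have l1 : 1 - eta < 1 by rewrite ltrBlDr ltrDl.
have [M1 [_ M1P]] := cvgr_gt _ c1 _ l1.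
have [M2 [_ M2P]] := cvgr_lt _ c0 _ eta0.
have h1 := ler_norm M1; have h2 := ler_norm (- M2); rewrite normrN in h2.
have := normr_ge0 M1; have := normr_ge0 M2 => h3 h4.
exists (1 + `|M1| + `|M2|); first lra.
by split; apply: ltW; [apply: M2P; lra|apply: M1P; lra].
Qed.

Lemma Phi_heat_lip : exists2 K : R, 0 < K & forall z h : R, 0 <= h <= 1 ->
  `|Phi (z / Num.sqrt (1 + h)) - Phi z| <= K * h.
Proof.
have [K1 K10 K1P] := Phi_heat R.
have [K2 K20 K2P] := phi_moment_bound R.
exists (K1 + K2); first by rewrite addr_gt0.
move=> z h /andP[h0 h1].
have zphi : `|z * phi z| <= K2.
  rewrite normrM (ger0_norm (phi_ge0 z)); apply: le_trans (K2P z).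
  by rewrite ler_wpM2r ?phi_ge0// norm_le_cube.
have -> : Phi (z / Num.sqrt (1 + h)) - Phi z =
  (Phi (z / Num.sqrt (1 + h)) - Phi z + h / 2 * (z * phi z)) - h / 2 * (z * phi z) by ring.
apply: le_trans (ler_normB _ _) _; rewrite [leRHS]mulrDl lerD//.
  apply: le_trans (K1P z h _) _; first by rewrite h0/=; lra.
  by rewrite ler_pM2l//; nra.
rewrite normrM ger0_norm ?divr_ge0// mulrC; apply: ler_pM => //; first by rewrite divr_ge0.
by lra.
Qed.

(** The indicator of [Q <= x] lies between [Phi (lam * (x - Q) - c) - eta] and
    [Phi (lam * (x - Q) + c) + eta]. The cube of [lam] comes from applying [lindeberg] to the
    dilated coefficients: one factor from the bound [lam * e], two from the sum of squares. *)
Lemma qform_prob_bounds : exists2 K : R, 0 < K & forall a b e N lam c eta x,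
  0 < lam -> lam * e <= 1 -> (forall j, (0 < j)%N -> `|a j| <= e) -> (forall j, (0 < j)%N -> `|b j| <= e) ->
  (forall j, (0 < j)%N -> lam ^+ 2 * quad_var (a j) (b j) <= 3) ->
  0 < c -> Phi (- c) <= eta -> 1 - eta <= Phi c ->
  let p := fine (P [set om | qform xi a b N om <= x]) in
  let s := Num.sqrt (1 + lam ^+ 2 * vsum a b N) in
  let err := K * (lam ^+ 3 * e * qsum a b N) + eta in
  Phi ((lam * x - c) / s) - err <= p <= Phi ((lam * x + c) / s) + err.
Proof.
have [K K0 KP] := lindeberg xi_iid.
exists K => // a b e N lam c eta x lam0 le1 ae be h3 c0 tm tp /=.
set p := fine _; set s := Num.sqrt _.
set err := K * (lam ^+ 3 * e * qsum a b N) + eta.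
pose a' j := lam * a j; pose b' j := lam * b j.
have sc (t : R) : `|t| <= e -> `|lam * t| <= lam * e.
  by move=> te; rewrite normrM gtr0_norm// ler_pM2l.
have ZE om : qform xi a' b' N om = lam * qform xi a b N om.
  rewrite /qform /psumRV mulr_sumr; apply: eq_bigr => j _; exact: quad_incrZ.
have VE : vsum a' b' N = lam ^+ 2 * vsum a b N.
  by rewrite /vsum mulr_sumr; apply: eq_bigr => j _; exact: quad_varZ.
have QE : qsum a' b' N = lam ^+ 2 * qsum a b N.
  by rewrite /qsum mulr_sumr; apply: eq_bigr => j _; rewrite /a' /b'; ring.
have L m : `|\int[P]_om Phi (m - qform xi a' b' N om) - Phi (m / s)|
    <= K * (lam ^+ 3 * e * qsum a b N).
  have := KP a' b' (lam * e) N le1 (fun j j0 => sc _ (ae j j0)) (fun j j0 => sc _ (be j j0)).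
  have h3' j : (0 < j)%N -> quad_var (a' j) (b' j) <= 3 by move=> j0; rewrite quad_varZ h3.
  move=> /(_ h3' 1 m (lexx _)); rewrite VE QE -/s.
  rewrite (@eq_Rintegral _ _ _ P setT (fun om => Phi (m - qform xi a' b' N om))).
    by move=> /le_trans; apply; rewrite le_eqVlt; apply/orP; left; apply/eqP; ring.
  by move=> om _; rewrite sqrtr1 divr1.
set A := [set om | qform xi a b N om <= x] in p *.
have mA : measurable A.
  rewrite -[A]setTI; have -> : A = qform xi a b N @^-1` `]-oo, x].
    by apply/seteqP; split => om /=; rewrite in_itv.
  exact: measurable_qform.
have I m : P.-integrable setT (EFin \o (fun om => Phi (m - qform xi a' b' N om))).
  apply: (@integrable_bounded _ _ _ _ _ 1).
    apply: measurableT_comp; first exact: measurable_Phi.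
    by apply: measurable_funB => //; exact: measurable_qform.
  by move=> om; rewrite ger0_norm ?Phi_ge0 ?Phi_le1.
have eta0 : 0 <= eta by apply: le_trans tm; exact: Phi_ge0.
apply/andP; split.
- have low om : Phi (lam * x - c - qform xi a' b' N om) <= \1_A om + eta.
    rewrite indicE; case: (boolP (om \in A)) => [_|].
      by rewrite (le_trans (Phi_le1 _))// lerDl.
    rewrite notin_setE /A /= => /negP; rewrite -ltNge => xZ.
    rewrite add0r; apply: le_trans tm; apply: Phi_homo; rewrite ZE.
    have : lam * x < lam * qform xi a b N om by rewrite ltr_pM2l.
    lra.
  have := indicator_integral mA (I _) low; rewrite -/p.
  have := L (lam * x - c); rewrite ler_norml => /andP[L1 L2]; rewrite /err; lra.
- have upp om : \1_A om <= Phi (lam * x + c - qform xi a' b' N om) + eta.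
    rewrite indicE; case: (boolP (om \in A)) => [|_]; last by rewrite addr_ge0 ?Phi_ge0.
    rewrite inE /A /= => Zx.
    have : Phi c <= Phi (lam * x + c - qform xi a' b' N om).
      apply: Phi_homo; rewrite ZE.
      have : lam * qform xi a b N om <= lam * x by rewrite ler_pM2l.
      lra.
    rewrite /=; lra.
  have := indicator_integral_ge mA (I _) upp; rewrite -/p.
  have := L (lam * x + c); rewrite ler_norml => /andP[L1 L2]; rewrite /err; lra.
Qed.

(** Four errors of [eta / 4] are budgeted: the tails of [Phi] beyond [c], the replacement, the shift
    by [c] and the extra unit of smoothing variance. *)
Lemma qform_clt (lo hi eta : R) : 0 < lo -> 0 < hi -> 0 < eta ->
  exists2 e : R, 0 < e & forall a b N x,
  (forall j, (0 < j)%N -> `|a j| <= e) -> (forall j, (0 < j)%N -> `|b j| <= e) ->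
  lo <= vsum a b N -> qsum a b N <= hi ->
  `|fine (P [set om | qform xi a b N om <= x]) - Phi (x / Num.sqrt (vsum a b N))| <= eta.
Proof.
move=> lo0 hi0 eta0.
have [K K0 KP] := qform_prob_bounds.
have [L L0 LP] := Phi_lipschitz.
have [H H0 HP] := Phi_heat_lip.
have e40 : 0 < eta / 4 by rewrite divr_gt0.
have [c c0 [tm tp]] := Phi_tails e40.
pose slo := Num.sqrt lo.
have slo0 : 0 < slo by rewrite sqrtr_gt0.
(* Each summand secures one requirement: [lam >= 1], [lam * lo >= 1], a negligible smoothing
   variance, a negligible shift by [c]. *)
pose lam := 1 + lo^-1 + 4 * H / (eta * lo) + 4 * L * c / (eta * slo).
have t1 : 0 < lo^-1 by rewrite invr_gt0.
have t2 : 0 < 4 * H / (eta * lo) by rewrite !mulr_gt0// invr_gt0 mulr_gt0.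
have t3 : 0 < 4 * L * c / (eta * slo) by rewrite !mulr_gt0// invr_gt0 mulr_gt0.
have lam1 : 1 <= lam by rewrite /lam; lra.
have lam0 : 0 < lam by lra.
have lamlo : 1 <= lam * lo by rewrite -ler_pdivrMr// mul1r /lam; lra.
have lamH : H / (lam * lo) <= eta / 4.
  rewrite ler_pdivrMr ?mulr_gt0//.
  have : 4 * H / (eta * lo) <= lam by rewrite /lam; lra.
  rewrite ler_pdivrMr ?mulr_gt0//; lra.
have lamL : L * c / (lam * slo) <= eta / 4.
  rewrite ler_pdivrMr ?mulr_gt0//.
  have : 4 * L * c / (eta * slo) <= lam by rewrite /lam; lra.
  rewrite ler_pdivrMr ?mulr_gt0//; lra.
pose cv := tau R + 4 * mu2 R.
have cv0 : 0 < cv by rewrite ltr_wpDr ?tau_gt0// mulr_ge0 ?mu2_ge0.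
(* With [e = 1 / q] the three summands give [lam * e <= 1], dilated variances of at most 1, and a
   replacement error of at most [eta / 4]. *)
pose q := lam + lam ^+ 2 * cv + 4 * K * lam ^+ 3 * hi / eta.
have q2 : 0 < lam ^+ 2 * cv by rewrite mulr_gt0 ?exprn_gt0.
have q3 : 0 < 4 * K * lam ^+ 3 * hi / eta by rewrite !mulr_gt0 ?invr_gt0 ?exprn_gt0.
have q0 : 0 < q by rewrite /q; lra.
have q1 : 1 <= q by rewrite /q; lra.
exists q^-1; first by rewrite invr_gt0.
move=> a b N x ae be vlo qhi.
set e := q^-1 in ae be.
have e0 : 0 < e by rewrite invr_gt0.
have e1 : e <= 1 by rewrite invf_le1.
have le1 : lam * e <= 1 by rewrite ler_pdivrMr// mul1r /q; lra.
have h3 j : (0 < j)%N -> lam ^+ 2 * quad_var (a j) (b j) <= 3.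
  move=> j0.
  have a2 : a j ^+ 2 <= e.
    rewrite -real_normK ?num_real// expr2; apply: le_trans (_ : e * 1 <= _); last by rewrite mulr1.
    by apply: ler_pM => //; rewrite ?ae//; apply: le_trans (ae j j0) _.
  have b2 : b j ^+ 2 <= e.
    rewrite -real_normK ?num_real// expr2; apply: le_trans (_ : e * 1 <= _); last by rewrite mulr1.
    by apply: ler_pM => //; rewrite ?be//; apply: le_trans (be j j0) _.
  have vb : quad_var (a j) (b j) <= cv * e.
    rewrite /quad_var /cv; have := tau_gt0 R; have := mu2_ge0 R; nra.
  apply: le_trans (_ : lam ^+ 2 * (cv * e) <= _).
    by apply: ler_wpM2l => //; exact: sqr_ge0.
  have : lam ^+ 2 * cv * e <= 1 by rewrite ler_pdivrMr// mul1r /q; lra.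
  lra.
have := KP a b e N lam c (eta / 4) x lam0 le1 ae be h3 c0 tm tp.
set p := fine _; move=> /=; set V := vsum a b N in vlo *.
have V0 : 0 < V by apply: lt_le_trans vlo.
set s := Num.sqrt (1 + _).
have errb : K * (lam ^+ 3 * e * qsum a b N) <= eta / 4.
  apply: le_trans (_ : K * (lam ^+ 3 * e * hi) <= _).
    rewrite ler_pM2l//; apply: ler_wpM2l => //.
    by rewrite mulr_ge0 ?exprn_ge0 ?ltW.
  have : 4 * K * lam ^+ 3 * hi / eta * e <= 1 by rewrite ler_pdivrMr// mul1r /q; lra.
  have -> : 4 * K * lam ^+ 3 * hi / eta * e = (4 * K * lam ^+ 3 * hi * e) / eta by ring.
  rewrite ler_pdivrMr// mul1r; lra.
have sV : lam * slo <= s.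
  have -> : lam * slo = Num.sqrt (lam ^+ 2 * lo).
    by rewrite sqrtrM ?sqr_ge0// sqrtr_sqr gtr0_norm.
  rewrite /s ler_sqrt; last by rewrite addr_ge0// ltW// mulr_gt0 ?exprn_gt0.
  apply: le_trans (_ : lam ^+ 2 * V <= _); first by rewrite ler_pM2l ?exprn_gt0.
  by rewrite lerDr.
have s0 : 0 < s by apply: lt_le_trans sV; rewrite mulr_gt0.
have cs : L * (c / s) <= eta / 4.
  apply: le_trans lamL; rewrite mulrA; apply: ler_wpM2l; first by rewrite mulr_ge0 ?ltW.
  by rewrite lef_pV2 ?posrE// mulr_gt0.
have sh1 : `|Phi ((lam * x + c) / s) - Phi (lam * x / s)| <= eta / 4.
  apply: le_trans (LP _ _) _; rewrite mulrDl addrAC subrr add0r.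
  by rewrite ger0_norm// divr_ge0 ?ltW.
have sh2 : `|Phi ((lam * x - c) / s) - Phi (lam * x / s)| <= eta / 4.
  apply: le_trans (LP _ _) _; rewrite mulrBl addrAC subrr add0r normrN.
  by rewrite ger0_norm// divr_ge0 ?ltW.
(* The smoothing variance 1 relative to the variance [lam^2 * V] of the dilated form. *)
pose h := (lam ^+ 2 * V)^-1.
have lV0 : 0 < lam ^+ 2 * V by rewrite mulr_gt0 ?exprn_gt0.
have h0 : 0 < h by rewrite invr_gt0.
have hle : h <= (lam * lo)^-1.
  rewrite lef_pV2 ?posrE ?mulr_gt0//; apply: ler_pM => //; try exact: ltW.
  by rewrite expr2 ler_peMl// ltW.
have h1 : h <= 1.
  by apply: le_trans hle _; rewrite invf_le1 ?mulr_gt0.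
have sh3 : `|Phi (lam * x / s) - Phi (x / Num.sqrt V)| <= eta / 4.
  have -> : lam * x / s = x / Num.sqrt V / Num.sqrt (1 + h).
    rewrite -[RHS]mulrA -invfM -sqrtrM ?ltW//.
    have -> : V * (1 + h) = (1 + lam ^+ 2 * V) / lam ^+ 2.
      by rewrite /h; field; rewrite !gt_eqF// .
    rewrite sqrtrM; last by rewrite addr_ge0 ?ltW.
    rewrite -/s sqrtrV ?sqr_ge0// sqrtr_sqr gtr0_norm//.
    by field; rewrite !gt_eqF.
  apply: le_trans (HP _ _ _) _; first by rewrite ltW.
  apply: le_trans lamH; rewrite ler_pM2l//.
move=> /andP[lowb uppb].
move: lowb uppb sh1 sh2 sh3 errb; clear.
move: (Phi _) (Phi _) (Phi _) (Phi _) (K * _) => f1 f2 f3 f4 k lowb uppb.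
rewrite ler_norml => /andP[_ s1]; rewrite ler_norml => /andP[s2 _].
rewrite ler_norml => /andP[s3 s4] errb; rewrite ler_norml; apply/andP; split; lra.
Qed.

End CentralLimit.

(** * Error probabilities of the test *)

Lemma psum_nondecreasing (R : realType) (u : nat -> R) : (forall j, 0 <= u j) ->
  nondecreasing_seq (psum u).
Proof.
move=> u0 M N MN; rewrite /psum.
have [M1|M1] := leqP 1 M; last first.
  by rewrite [leLHS]big_geq; [exact: sumr_ge0|exact: ltnW].
by rewrite (big_cat_nat M1 MN)/= lerDl sumr_ge0.
Qed.

Section TestStatistic.
Context (d : measure_display) (T : measurableType d) (R : realType).
Variables (P : probability T R) (xi : nat -> {RV P >-> R}).
Hypothesis xi_iid : iid_std_normal xi.
Variables (sigma : R) (w : nat -> nat -> R).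
Hypothesis w_ge0 : forall n j, 0 <= w n j.
Hypothesis w_cvg : forall n, cvgn (psum (w n)).
Implicit Types (theta : nat -> R) (n N j : nat) (t x : R).

Definition acoef n j : R := sigma ^+ 2 * n%:R * w n j.

Definition bcoef theta n j : R :=
  n%:R ^+ 2 * w n j * theta j * (sigma / Num.sqrt n%:R).

Definition dcoef theta n j : R := n%:R ^+ 2 * w n j * theta j ^+ 2.

(** The statistic is centred as if the second moment were 1, the increments by [mu2]; the second
    term reconciles the two centrings. *)
Definition null_threshold n t : R :=
  n%:R ^+ 2 * t - (mu2 R - 1) * (sigma ^+ 2 * n%:R * rho w n).

Lemma stat_term theta n j x : (0 < n)%N ->
  n%:R ^+ 2 * (w n j * (theta j + sigma / Num.sqrt n%:R * x) ^+ 2) =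
  quad_incr (acoef n j) (bcoef theta n j) x + (mu2 R * acoef n j + dcoef theta n j).
Proof.
move=> n0; have n0R : 0 < n%:R :> R by rewrite ltr0n.
set q := sigma / Num.sqrt n%:R.
have q2 : n%:R ^+ 2 * q ^+ 2 = sigma ^+ 2 * n%:R.
  rewrite /q expr_div_n sqr_sqrtr ?ltW//; field; exact: lt0r_neq0.
rewrite /quad_incr /acoef -q2 /bcoef /dcoef -/q; ring.
Qed.

Definition trunc_threshold theta n t N : R :=
  n%:R ^+ 2 * (t + sigma ^+ 2 / n%:R * rho w n)
  - (mu2 R * psum (acoef n) N + psum (dcoef theta n) N).

Lemma partial_stat_le theta n t N om : (0 < n)%N ->
  (\sum_(1 <= j < N) (w n j * (theta j + sigma / Num.sqrt n%:R * xi j om) ^+ 2)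
    <= t + sigma ^+ 2 / n%:R * rho w n) =
  (qform xi (acoef n) (bcoef theta n) N om <= trunc_threshold theta n t N).
Proof.
move=> n0; have n0R : 0 < n%:R :> R by rewrite ltr0n.
rewrite -(ler_pM2l (_ : 0 < n%:R ^+ 2)) ?exprn_gt0//.
have -> : n%:R ^+ 2 * (\sum_(1 <= j < N)
      (w n j * (theta j + sigma / Num.sqrt n%:R * xi j om) ^+ 2)) =
    qform xi (acoef n) (bcoef theta n) N om
    + (mu2 R * psum (acoef n) N + psum (dcoef theta n) N).
  rewrite /qform /psumRV /psum [X in _ = _ + (X + _)]mulr_sumr -!big_split mulr_sumr.
  by apply: eq_bigr => j _; rewrite stat_term.
by rewrite /trunc_threshold lerBrDr.
Qed.

(** A series of nonnegative terms stays below a level exactly when all its partial sums do. The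
    truncated thresholds depend on [N] because the increments are centred one by one. *)
Lemma typeII_event theta n t : (0 < n)%N ->
  [set om | (Tstat xi sigma w theta n om <= t%:E)%E] =
  \bigcap_N [set om | qform xi (acoef n) (bcoef theta n) N om <= trunc_threshold theta n t N].
Proof.
move=> n0; have n0R : 0 < n%:R :> R by rewrite ltr0n.
pose f j om : R := w n j * (theta j + sigma / Num.sqrt n%:R * xi j om) ^+ 2.
have f0 j om : 0 <= f j om by rewrite mulr_ge0 ?sqr_ge0.
set r := t + sigma ^+ 2 / n%:R * rho w n.
have partial N om := partial_stat_le theta t N om n0.
apply/seteqP; split => om /=.
- rewrite /Tstat leeBlDr// -EFinD -/r => H N _ /=; rewrite -partial -lee_fin.
  rewrite -sumEFin; apply: le_trans H.
  by apply: nneseries_lim_ge => j _ _; rewrite lee_fin f0.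
- move=> H; rewrite /Tstat leeBlDr// -EFinD -/r.
  apply: lime_le; first by apply: is_cvg_nneseries => j _ _; rewrite lee_fin f0.
  by apply: nearW => N; rewrite sumEFin lee_fin partial; exact: H.
Qed.

Lemma measurable_trunc_event theta n t N :
  measurable [set om | qform xi (acoef n) (bcoef theta n) N om <= trunc_threshold theta n t N].
Proof.
rewrite -[X in measurable X]setTI.
have -> : [set om | qform xi (acoef n) (bcoef theta n) N om <= trunc_threshold theta n t N]
   = qform xi (acoef n) (bcoef theta n) N @^-1` `]-oo, trunc_threshold theta n t N].
  by apply/seteqP; split => om /=; rewrite in_itv.
exact: measurable_qform.
Qed.

Lemma measurable_typeII_event theta n t : (0 < n)%N ->
  measurable [set om | (Tstat xi sigma w theta n om <= t%:E)%E].
Proof.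
move=> n0; rewrite typeII_event//; apply: bigcap_measurable => // N _.
exact: measurable_trunc_event.
Qed.

Lemma typeII_fin_num theta n t : (0 < n)%N -> typeII xi sigma w theta n t \is a fin_num.
Proof. by move=> n0; apply: fin_num_measure; exact: measurable_typeII_event. Qed.

Lemma typeI_typeII n t : (0 < n)%N ->
  typeI xi sigma w n t = (1 - typeII xi sigma w (fun=> 0%R) n t)%E.
Proof.
move=> n0; rewrite /typeI /typeII -probability_setC; last exact: measurable_typeII_event.
congr (P _); apply/seteqP; split => om /=; first by rewrite ltNge => /negP.
by move=> /negP; rewrite -ltNge.
Qed.

Lemma cvg_trunc_event theta n t : (0 < n)%N ->
  (fun N => fine (P [set om | qform xi (acoef n) (bcoef theta n) N om
                               <= trunc_threshold theta n t N])) @ \oo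
  --> fine (typeII xi sigma w theta n t).
Proof.
move=> n0; have n0R : 0 < n%:R :> R by rewrite ltr0n.
apply: fine_cvg; rewrite fineK ?typeII_fin_num// /typeII typeII_event//.
apply: nonincreasing_cvg_mu.
- rewrite (le_lt_trans (probability_le1 _ _)) ?ltry//.
  exact: measurable_trunc_event.
- by move=> N; exact: measurable_trunc_event.
- by apply: bigcap_measurable => // N _; exact: measurable_trunc_event.
pose f j om : R := w n j * (theta j + sigma / Num.sqrt n%:R * xi j om) ^+ 2.
have f0 j om : 0 <= f j om by rewrite mulr_ge0 ?sqr_ge0.
set r := t + sigma ^+ 2 / n%:R * rho w n.
have partial N om := partial_stat_le theta t N om n0.
(* The events are seen to decrease in the uncentred form, where all the terms are nonnegative. *)
move=> M N MN; apply/subsetPset => om /=; rewrite -!partial; apply: le_trans.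
by apply: (psum_nondecreasing (u := fun j => f j om)).
Qed.

Lemma cvg_psumM (u : nat -> R) (c l : R) : psum u @ \oo --> l ->
  psum (fun j => c * u j) @ \oo --> c * l.
Proof.
move=> ul; have -> : psum (fun j => c * u j) = (fun N => c * psum u N).
  by apply/funext => N; rewrite /psum mulr_sumr.
by apply: cvgM => //; exact: cvg_cst.
Qed.

Lemma cvg_trunc_threshold theta n t D : (0 < n)%N ->
  psum (dcoef theta n) @ \oo --> D ->
  trunc_threshold theta n t @ \oo --> null_threshold n t - D.
Proof.
move=> n0 dD; have n0R : 0 < n%:R :> R by rewrite ltr0n.
have -> : null_threshold n t - D = n%:R ^+ 2 * (t + sigma ^+ 2 / n%:R * rho w n)
  - (mu2 R * (sigma ^+ 2 * n%:R * rho w n) + D).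
  by rewrite /null_threshold; field; exact: lt0r_neq0.
apply: (@cvgB _ R^o); first exact: cvg_cst.
apply: (@cvgD _ R^o) => //; apply: cvgM; first exact: cvg_cst.
exact/cvg_psumM/w_cvg.
Qed.

(** The [e] of [qform_clt] serves all truncations [N] at once, so its bound passes to the limit. The
    strict [lo < V] puts the truncated variances above [lo] eventually. *)
Lemma typeII_clt (lo hi eta : R) : 0 < lo -> 0 < hi -> 0 < eta ->
  exists2 e : R, 0 < e & forall theta n t V D, (0 < n)%N ->
  (forall j, (0 < j)%N -> `|acoef n j| <= e) ->
  (forall j, (0 < j)%N -> `|bcoef theta n j| <= e) ->
  vsum (acoef n) (bcoef theta n) @ \oo --> V -> lo < V ->
  (forall N, qsum (acoef n) (bcoef theta n) N <= hi) ->
  psum (dcoef theta n) @ \oo --> D ->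
  `|fine (typeII xi sigma w theta n t) - Phi ((null_threshold n t - D) / Num.sqrt V)| <= eta.
Proof.
move=> lo0 hi0 eta0; have [e e0 eP] := qform_clt xi_iid lo0 hi0 eta0.
exists e => // theta n t V D n0 ae be vV loV qhi dD.
have c1 := @cvg_trunc_event theta n t n0.
have c2 : (fun N => trunc_threshold theta n t N / Num.sqrt (vsum (acoef n) (bcoef theta n) N))
    @ \oo --> (null_threshold n t - D) / Num.sqrt V.
  apply: cvgM; first exact: cvg_trunc_threshold.
  apply: cvgV; first by rewrite sqrtr_eq0 -ltNge (lt_trans lo0).
  by apply: (continuous_cvg _ _ vV); exact: sqrt_continuous.
have c3 : (fun N => Phi (trunc_threshold theta n t N
      / Num.sqrt (vsum (acoef n) (bcoef theta n) N))) @ \oo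
    --> Phi ((null_threshold n t - D) / Num.sqrt V).
  exact: (continuous_cvg _ (@continuous_Phi R _) c2).
have c4 : (fun N => `|fine (P [set om | qform xi (acoef n) (bcoef theta n) N om
        <= trunc_threshold theta n t N])
      - Phi (trunc_threshold theta n t N / Num.sqrt (vsum (acoef n) (bcoef theta n) N))|) @ \oo
    --> `|fine (typeII xi sigma w theta n t) - Phi ((null_threshold n t - D) / Num.sqrt V)|.
  by apply: (@cvg_norm _ R^o); exact: (@cvgB _ R^o).
move: c4 => /cvgr_to_le; apply.
have : \forall N \near \oo, lo < vsum (acoef n) (bcoef theta n) N by exact: cvgr_gt vV _ loV.
apply: filterS => N loN; apply: eP => //; exact: ltW.
Qed.

End TestStatistic.

(** * Asymptotic power *)

Section AsymptoticPower.
Variable R : realType.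
Implicit Types (x y z c s eta delta kappa : R) (n : nat).

(** Turns the strict inequality in [consistent] into an eventual gap [kappa], which is real because
    nonnegativity excludes a supremum of [-oo]. *)
Lemma limn_esup_ltP (u : nat -> \bar R) (l : R) : (forall n, (0 <= u n)%E) ->
  (limn_esup u < l%:E)%E <->
  exists2 kappa : R, 0 < kappa & \forall n \near \oo, (u n <= (l - kappa)%:E)%E.
Proof.
move=> u0; split.
- rewrite /limn_esup /limf_esup => /ereal_inf_lt[_ [V VF <-] supl].
  have uV n : V n -> (u n <= ereal_sup (u @` V))%E.
    by move=> Vn; apply: ereal_sup_ubound; exists n.
  have [n0 Vn0] : exists n, V n by apply: filter_ex VF.
  have sup0 : (0 <= ereal_sup (u @` V))%E by apply: le_trans (uV _ Vn0).
  move: supl sup0 uV; case: (ereal_sup _) => [r|//|//] rl r0 uV.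
  rewrite lte_fin in rl.
  exists (l - r); first by rewrite subr_gt0.
  by apply: filterS VF => n /uV; rewrite subKr.
- move=> [kappa k0 uk]; apply: (@le_lt_trans _ _ (l - kappa)%:E).
    rewrite /limn_esup /limf_esup; set V := (X in \forall n \near \oo, X n) in uk.
    apply: le_trans (_ : ereal_sup (u @` [set n | (u n <= (l - kappa)%:E)%E]) <= _)%E.
      by apply: ereal_inf_lbound; exists [set n | (u n <= (l - kappa)%:E)%E].
    by apply: ge_ereal_sup => _ [n /= un <-].
  by rewrite lte_fin ltrBlDr ltrDl.
Qed.

(** Between [z - s] and [z] the density is at least [phi (c + s)]. *)
Lemma Phi_gap c s : 0 < s ->
  exists2 kappa : R, 0 < kappa & forall z, `|z| <= c -> Phi (z - s) <= Phi z - kappa.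
Proof.
move=> s0; exists (phi (c + s) * s); first by rewrite mulr_gt0// phi_gt0.
move=> z zc; have zs : z - s < z by rewrite ltrBlDr ltrDl.
have [|y] := @MVT R (@Phi R) (@phi R) _ _ zs (fun t _ => is_derive_Phi t).
  by apply: continuous_subspaceT => t; exact: continuous_Phi.
rewrite in_itv /= => /andP[y1 y2] E.
have -> : Phi (z - s) = Phi z - phi y * s by move: E; rewrite opprB addrCA subrr addr0 => <-; ring.
rewrite lerD2l lerN2 ler_pM2r// !phiE ler_pM2l ?normal_peak_gt0 ?oner_neq0//.
rewrite ler_expR ler_pM2r ?invr_gt0// lerN2.
have yc : `|y| <= c + s.
  move: zc; rewrite !ler_norml => /andP[z1 z2]; apply/andP; split; lra.
by rewrite -[y ^+ 2]real_normK ?num_real// lerXn2r ?nnegrE// (le_trans _ yc).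
Qed.

Lemma sqrt_ratio_le (v0 v lo : R) : 0 < lo -> lo <= v0 -> v0 <= v ->
  `|1 - Num.sqrt v0 / Num.sqrt v| <= (v - v0) / lo.
Proof.
move=> lo0 lov0 v0v.
have v00 : 0 < v0 by apply: lt_le_trans lov0.
have vp : 0 < v by apply: lt_le_trans v0v.
set s0 := Num.sqrt v0; set s := Num.sqrt v.
have s00 : 0 < s0 by rewrite sqrtr_gt0.
have sp : 0 < s by rewrite sqrtr_gt0.
have s02 : s0 ^+ 2 = v0 by rewrite sqr_sqrtr// ltW.
have s2 : s ^+ 2 = v by rewrite sqr_sqrtr// ltW.
have s0s : s0 <= s by rewrite /s0 /s ler_sqrt// ltW.
rewrite ger0_norm; last by rewrite subr_ge0 ler_pdivrMr// mul1r.
apply: (@le_trans _ _ ((v - v0) / v)); last first.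
  by apply: ler_wpM2l; rewrite ?subr_ge0// lef_pV2 ?posrE// (le_trans lov0).
have -> : 1 - s0 / s = (v - s0 * s) / v by rewrite -s2; field; exact: lt0r_neq0.
by rewrite ler_pM2r ?invr_gt0// lerD2l lerN2 -s02 expr2 ler_pM2l.
Qed.

(** * Shift and power gap: [bet] and [gam] are acceptance probabilities under the alternative and
    the hypothesis *)

Section Criterion.
Variables (bet gam X : nat -> R -> R) (D V V0 : nat -> R) (lo hi : R).
Hypothesis lo_gt0 : 0 < lo.
Hypothesis D_ge0 : forall n, (0 < n)%N -> 0 <= D n.
Hypothesis V0_lo : forall n, (0 < n)%N -> lo <= V0 n.
Hypothesis V0_V : forall n, (0 < n)%N -> V0 n <= V n.
Hypothesis hi_gt0 : 0 < hi.
Hypothesis V_hi : \forall n \near \oo, V n <= hi.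
Hypothesis V_close : forall eta, 0 < eta -> \forall n \near \oo, V n - V0 n <= eta.
Hypothesis gam_clt : forall eta, 0 < eta -> \forall n \near \oo, forall t,
  `|gam n t - Phi (X n t / Num.sqrt (V0 n))| <= eta.
Hypothesis bet_clt : forall eta, 0 < eta -> \forall n \near \oo, forall t,
  `|bet n t - Phi ((X n t - D n) / Num.sqrt (V n))| <= eta.

(** At these thresholds [bet] is close to [Phi (- D / sqrt V)], which differs from [Phi 0] by at
    most [L * D / sqrt lo]. A power gap thus bounds [D] below. *)
Lemma shift_of_power_gap (t : nat -> R) kappa : 0 < kappa ->
  (forall n, (0 < n)%N -> X n (t n) = 0) ->
  (\forall n \near \oo, bet n (t n) <= Phi 0 - kappa) ->
  exists2 delta : R, 0 < delta & \forall n \near \oo, delta <= D n.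
Proof.
move=> k0 X0 bk; have [L L0 LP] := Phi_lipschitz R.
have slo0 : 0 < Num.sqrt lo by rewrite sqrtr_gt0.
have k20 : 0 < kappa / 2 by rewrite divr_gt0.
exists (kappa / 2 * Num.sqrt lo / L); first by rewrite divr_gt0// mulr_gt0.
near=> n.
have n0 : (0 < n)%N by near: n; exact: nbhs_infty_gt.
have b1 : bet n (t n) <= Phi 0 - kappa by near: n.
have : forall t, `|bet n t - Phi ((X n t - D n) / Num.sqrt (V n))| <= kappa / 2.
  by near: n; exact: bet_clt.
move=> /(_ (t n)); rewrite X0// sub0r ler_norml => /andP[b2 _].
have sV : Num.sqrt lo <= Num.sqrt (V n).
  by rewrite ler_sqrt; [exact: le_trans (V0_lo n0) (V0_V n0)|
    apply: ltW; apply: lt_le_trans lo_gt0 (le_trans (V0_lo n0) (V0_V n0))].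
have sV0 : 0 < Num.sqrt (V n) by apply: lt_le_trans sV.
have := LP (- D n / Num.sqrt (V n)) 0; rewrite sub0r normrN => lip.
have Dn : `|- D n / Num.sqrt (V n)| <= D n / Num.sqrt lo.
  have i0 : 0 <= (Num.sqrt (V n))^-1 by rewrite invr_ge0 ltW.
  rewrite normrM normrN (ger0_norm (D_ge0 n0)) (ger0_norm i0).
  by apply: ler_wpM2l; [exact: D_ge0|rewrite lef_pV2 ?posrE].
have gap : kappa / 2 <= L * (D n / Num.sqrt lo).
  apply: le_trans (_ : L * `|- D n / Num.sqrt (V n)| <= _); last by rewrite ler_pM2l.
  apply: le_trans lip; rewrite ler_normr; apply/orP; left; lra.
rewrite ler_pdivrMr// -ler_pdivlMr//; apply: le_trans gap _.
by rewrite mulrA [L * _]mulrC.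
Unshelve. all: by end_near. Qed.

Lemma power_gap_of_shift delta (alpha : R) (t : nat -> R) :
  0 < delta -> 0 < alpha < 1 ->
  (\forall n \near \oo, delta <= D n) ->
  (fun n => gam n (t n)) @ \oo --> 1 - alpha ->
  exists2 kappa : R, 0 < kappa & \forall n \near \oo, bet n (t n) <= 1 - alpha - kappa.
Proof.
move=> d0 /andP[a0 a1] dD gcv.
(* [Phi z] will be within [2 * m] of [1 - alpha], hence strictly between [m] and [1 - m]; this
   forces [z] into [[-c, c]]. *)
pose m := Num.min (alpha / 4) ((1 - alpha) / 4).
have m0 : 0 < m by rewrite lt_min !divr_gt0// subr_gt0.
have ma : m <= alpha / 4 by rewrite ge_min lexx.
have m1a : m <= (1 - alpha) / 4 by rewrite ge_min lexx orbT.
have [c c0 [tm tp]] := Phi_tails m0.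
(* The shift is worth at least [2 * s] after normalisation; one [s] pays for exchanging [V0] and [V]
   under the threshold. *)
pose s := delta / (2 * Num.sqrt hi).
have shi0 : 0 < Num.sqrt hi by rewrite sqrtr_gt0.
have s0 : 0 < s by rewrite divr_gt0// mulr_gt0.
have [kappa k0 gap] := Phi_gap c s0.
(* Three errors of [kappa / 6] leave half of the gap. *)
have k60 : 0 < kappa / 6 by rewrite divr_gt0.
have e0 : 0 < s * lo / c by rewrite divr_gt0// mulr_gt0.
exists (kappa / 2); first by rewrite divr_gt0.
have N1 := bet_clt k60; have N2 := gam_clt k60; have N3 := gam_clt m0.
have N4 := V_close e0.
have N5 : \forall n \near \oo, `|1 - alpha - gam n (t n)| < kappa / 6.
  by move/cvgrPdist_lt : gcv; exact.
have N6 : \forall n \near \oo, `|1 - alpha - gam n (t n)| < m.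
  by move/cvgrPdist_lt : gcv; exact.
near=> n.
have n0 : (0 < n)%N by near: n; exact: nbhs_infty_gt.
have dn : delta <= D n by near: n.
have B : forall t, `|bet n t - Phi ((X n t - D n) / Num.sqrt (V n))| <= kappa / 6.
  by near: n; exact: N1.
have G : forall t, `|gam n t - Phi (X n t / Num.sqrt (V0 n))| <= kappa / 6.
  by near: n; exact: N2.
have G' : forall t, `|gam n t - Phi (X n t / Num.sqrt (V0 n))| <= m.
  by near: n; exact: N3.
have C : V n - V0 n <= s * lo / c by near: n; exact: N4.
have g1 : `|1 - alpha - gam n (t n)| < kappa / 6.
  by near: n; exact: N5.
have g2 : `|1 - alpha - gam n (t n)| < m.
  by near: n; exact: N6.
have {}B := B (t n); have {}G := G (t n); have {}G' := G' (t n).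
set x := X n (t n) in B G G'.
have lV0 := V0_lo n0; have VV := V0_V n0; have Vh : V n <= hi by near: n; exact: V_hi.
have V00 : 0 < V0 n by apply: lt_le_trans lV0.
have Vp : 0 < V n by apply: lt_le_trans VV.
have sV0 : 0 < Num.sqrt (V0 n) by rewrite sqrtr_gt0.
have sV : 0 < Num.sqrt (V n) by rewrite sqrtr_gt0.
set z := x / Num.sqrt (V0 n) in G G'.
have zc : `|z| <= c.
  move: G' g2; rewrite ler_norml ltr_norml => /andP[h1 h2] /andP[h3 h4].
  rewrite ler_norml; apply/andP; split; rewrite leNgt; apply/negP => zz.
  - have : Phi z <= Phi (- c) by apply: Phi_homo; exact: ltW.
    lra.
  - have : Phi c <= Phi z by apply: Phi_homo; exact: ltW.
    lra.
have le_arg : (x - D n) / Num.sqrt (V n) <= z - s.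
  have xE : x / Num.sqrt (V n) = z * (Num.sqrt (V0 n) / Num.sqrt (V n)).
    by rewrite /z; field; rewrite !lt0r_neq0.
  have rz := sqrt_ratio_le lo_gt0 lV0 VV.
  set rr := Num.sqrt (V0 n) / _ in xE rz.
  have d1 : z * rr - z <= s.
    have -> : z * rr - z = - (z * (1 - rr)) by ring.
    apply: le_trans (ler_norm _) _; rewrite normrN normrM.
    apply: le_trans (_ : c * (s * lo / c / lo) <= _).
      apply: ler_pM => //; apply: le_trans rz _; by rewrite ler_pM2r ?invr_gt0.
    by rewrite le_eqVlt; apply/orP; left; apply/eqP; field; rewrite !lt0r_neq0.
  have d2 : 2 * s <= D n / Num.sqrt (V n).
    rewrite /s ler_pdivlMr//.
    have -> : 2 * (delta / (2 * Num.sqrt hi)) * Num.sqrt (V n) = delta * (Num.sqrt (V n) / Num.sqrt hi).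
      by field; rewrite lt0r_neq0.
    apply: le_trans dn; rewrite ger_pMr// ler_pdivrMr// mul1r ler_sqrt//.
    exact: ltW.
  by rewrite mulrBl xE; lra.
have := gap z zc; have := Phi_homo le_arg.
move: B G g1; rewrite !ler_norml ltr_norml => /andP[_ h1] /andP[h2 h3] /andP[h4 h5] h6 h7.
lra.
Unshelve. all: by end_near. Qed.

End Criterion.

End AsymptoticPower.

(** * Weights *)

Section PartialSums.
Variable R : realType.
Implicit Types (u v : nat -> R) (x y : R) (N j k : nat).

Lemma psum_ge0 u N : (forall j, (0 < j)%N -> 0 <= u j) -> 0 <= psum u N.
Proof.
by move=> u0; rewrite /psum big_nat_cond sumr_ge0// => j /andP[/andP[j1 _] _]; exact: u0.
Qed.

Lemma le_psum u v N : (forall j, (0 < j)%N -> u j <= v j) -> psum u N <= psum v N.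
Proof. by move=> uv; rewrite /psum ler_sum_nat// => j /andP[j1 _]; exact: uv. Qed.

Lemma psumZ x u N : psum (fun j => x * u j) N = x * psum u N.
Proof. by rewrite /psum mulr_sumr. Qed.

Lemma psum_le_lim u N : (forall j, 0 <= u j) -> cvgn (psum u) -> psum u N <= limn (psum u).
Proof. by move=> u0 cu; apply: nondecreasing_cvgn_le => //; exact: psum_nondecreasing. Qed.

Lemma psum_cvg_bounded u x : (forall j, 0 <= u j) -> (forall N, psum u N <= x) ->
  cvgn (psum u) /\ limn (psum u) <= x.
Proof.
move=> u0 ux.
have cu : cvgn (psum u).
  apply: nondecreasing_is_cvgn; first exact: psum_nondecreasing.
  by exists x => _ [N _ <-].
by split => //; apply: limr_le => //; exact: nearW.
Qed.

Lemma psum_const x k : psum (fun=> x) k.+1 = k%:R * x.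
Proof. by rewrite /psum big_const_nat iter_addr_0 subn1 /= mulr_natl. Qed.

Lemma term_le_psum u j : (0 < j)%N -> (forall i, 0 <= u i) -> u j <= psum u j.+1.
Proof.
by move=> j0 u0; rewrite /psum big_nat_recr//= lerDr sumr_ge0.
Qed.

(* Only the indices [j < x] contribute, so the upper summation limit is immaterial
   as soon as it exceeds [x]. *)
Lemma filtered_psum_le u x N : (forall j, 0 <= u j) ->
  \sum_(1 <= j < N | j%:R < x) u j <=
  \sum_(1 <= j < (Num.truncn x).+1 | j%:R < x) u j.
Proof.
move=> u0; set M := (Num.truncn x).+1.
have M1 : (1 <= M)%N by [].
have big0 p q : (M <= p)%N -> \sum_(p <= j < q | j%:R < x) u j = 0.
  move=> Mp; rewrite big_nat_cond big_pred0// => j.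
  apply/negP => /andP[/andP[pj _] jx].
  have x0 : 0 <= x by apply: le_trans (ltW jx); rewrite ler0n.
  have := leq_trans Mp pj; rewrite /M ltnNge => /negP; apply.
  by rewrite truncn_ge_nat// ltW.
have [NM|MN] := leqP N M.
  have [N1|N0] := leqP 1 N.
    by rewrite [leRHS](big_cat_nat N1 NM)/= lerDl sumr_ge0.
  by rewrite [leLHS]big_geq; [exact: sumr_ge0|exact: ltnW].
by rewrite (big_cat_nat M1 (ltnW MN))/= (big0 M N (leqnn _)) addr0.
Qed.

(** The sum of squares is of the order of [u 1 * S]. The upper bound uses [u j <= u 1]. For the
    lower one, maximality of [k] gives [S / 2 < k * u 1], while the first [k] squares sum to at
    least [k * u k ^ 2], comparable with [k * u 1 ^ 2]. *)
Lemma weight_sums (u : nat -> R) k S q : (forall j, 0 <= u j) ->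
  (forall i j, (1 <= i <= j)%N -> u j <= u i) ->
  cvgn (psum u) -> S = limn (psum u) ->
  psum u k <= S / 2 -> (forall k', psum u k' <= S / 2 -> (k' <= k)%N) ->
  0 < u k -> u 1%N <= q * u k ->
  [/\ cvgn (psum (fun j => u j ^+ 2)),
      limn (psum (fun j => u j ^+ 2)) <= u 1%N * S &
      u 1%N * S <= 2 * q ^+ 2 * limn (psum (fun j => u j ^+ 2))].
Proof.
move=> u0 anti cu SE kS kmax uk uq.
have S0 : 0 <= S.
  by rewrite SE; apply: le_trans (psum_le_lim 0 u0 cu); rewrite psum_ge0.
have k1 : (1 <= k)%N by apply: kmax; rewrite /psum big_geq// divr_ge0.
have u2 j : (0 < j)%N -> u j ^+ 2 <= u 1%N * u j.
  by move=> j0; rewrite expr2 ler_wpM2r// anti// j0.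
have ub N : psum (fun j => u j ^+ 2) N <= u 1%N * S.
  apply: le_trans (le_psum N u2) _; rewrite psumZ; apply: ler_wpM2l => //.
  by rewrite SE; exact: psum_le_lim.
have sq0 j : 0 <= u j ^+ 2 by exact: sqr_ge0.
have [c2 l2] := psum_cvg_bounded sq0 ub.
split => //; set s2 := limn _.
have half : S / 2 < k%:R * u 1%N.
  rewrite -psum_const; apply: (@lt_le_trans _ _ (psum u k.+1)).
    by rewrite ltNge; apply/negP => /kmax; rewrite ltnn.
  by apply: le_psum => j j0; exact: anti.
have low : k%:R * u k ^+ 2 <= s2.
  apply: le_trans (psum_le_lim k.+1 sq0 c2); rewrite -psum_const /psum.
  apply: ler_sum_nat => j /andP[j1 jk].
  by rewrite lerXn2r ?nnegrE// anti// j1 -ltnS.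
have k0 : 0 <= k%:R :> R by rewrite ler0n.
have u1q : u 1%N ^+ 2 <= q ^+ 2 * u k ^+ 2.
  by rewrite -exprMn lerXn2r ?nnegrE// (le_trans (u0 1%N) uq).
apply: le_trans (_ : 2 * (k%:R * u 1%N ^+ 2) <= _).
  by have := ler_wpM2l (u0 1%N) (ltW half); rewrite expr2; lra.
apply: le_trans (_ : 2 * (q ^+ 2 * (k%:R * u k ^+ 2)) <= _).
  by have := ler_wpM2l k0 u1q; lra.
by have := ler_wpM2l (sqr_ge0 q) low; lra.
Qed.

End PartialSums.

(** * Orders of magnitude of the coefficients, and the frequency cutoff *)

Section Weights.
Variables (R : realType) (sigma r : R) (w : nat -> nat -> R) (kn : nat -> nat).
Variables (theta : nat -> nat -> R) (A1 A2 p1 p2 q C : R).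
Hypotheses (sigma_gt0 : 0 < sigma) (r_lt : r < 1 / 2).
Hypothesis w_ge0 : forall n j, 0 <= w n j.
Hypothesis w_cvg : forall n, cvgn (psum (w n)).
Hypothesis kn_spec : forall n, (0 < n)%N -> is_kn w n (kn n).
Hypothesis w_anti : forall n i j, (1 <= i <= j)%N -> w n j <= w n i.
Hypotheses (A1_gt0 : 0 < A1) (A2_gt0 : 0 < A2) (p1_gt0 : 0 < p1) (p2_gt0 : 0 < p2)
  (q_gt0 : 0 < q).
Hypothesis hA : forall n, (0 < n)%N ->
  A1 < sigma ^- 4 * n%:R ^+ 2 * limn (psum (fun j => w n j ^+ 2)) < A2.
Hypothesis hrho : forall n, (0 < n)%N ->
  p1 * n%:R `^ (- (2 * r)) <= rho w n <= p2 * n%:R `^ (- (2 * r)).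
Hypothesis wk_gt0 : forall n, (0 < n)%N -> 0 < w n (kn n).
Hypothesis w1_wk : forall n, (0 < n)%N -> w n 1%N <= q * w n (kn n).
Hypothesis C_gt0 : 0 < C.
Hypothesis theta_cvg : forall n, cvgn (psum (fun j => theta n j ^+ 2)).
Hypothesis theta_le : forall n, (0 < n)%N ->
  limn (psum (fun j => theta n j ^+ 2)) <= C ^+ 2 * n%:R `^ (- (2 * r)).

Local Notation y n := (n%:R `^ (- (2 * r)) : R).
Local Notation a := (acoef sigma w).
Local Notation b n := (bcoef sigma w (theta n) n).
Local Notation dd n := (dcoef w (theta n) n).

Definition Kup : R := 2 * q ^+ 2 * (sigma ^+ 4 * A2) / p1.

Definition Klo : R := sigma ^+ 4 * A1 / p2.

Lemma Kup_gt0 : 0 < Kup.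
Proof. by rewrite /Kup divr_gt0// !mulr_gt0// exprn_gt0. Qed.

Lemma Klo_gt0 : 0 < Klo.
Proof. by rewrite /Klo divr_gt0// mulr_gt0// exprn_gt0. Qed.

Lemma y_gt0 n : (0 < n)%N -> 0 < y n.
Proof. by move=> n0; rewrite powR_gt0// ltr0n. Qed.

Lemma kn_ge1 n : (0 < n)%N -> (1 <= kn n)%N.
Proof.
move=> n0; have [_] := kn_spec n0; apply; rewrite /psum big_geq// divr_ge0//.
have /andP[h _] := hrho n0; apply: le_trans h.
by rewrite mulr_ge0 ?ltW// y_gt0.
Qed.

Lemma wk_le_w1 n : (0 < n)%N -> w n (kn n) <= w n 1%N.
Proof. by move=> n0; apply: w_anti; rewrite kn_ge1. Qed.

Lemma w1_gt0 n : (0 < n)%N -> 0 < w n 1%N.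
Proof. by move=> n0; exact: lt_le_trans (wk_gt0 n0) (wk_le_w1 n0). Qed.

Lemma sq_sum n : (0 < n)%N ->
  [/\ cvgn (psum (fun j => w n j ^+ 2)),
      limn (psum (fun j => w n j ^+ 2)) <= w n 1%N * rho w n &
      w n 1%N * rho w n <= 2 * q ^+ 2 * limn (psum (fun j => w n j ^+ 2))].
Proof.
move=> n0; have [k1 k2] := kn_spec n0.
have [] := weight_sums (w_ge0 n) (@w_anti n) (@w_cvg n) erefl k1 k2 (wk_gt0 n0) (w1_wk n0).
by split.
Qed.

Lemma sq_sum_bounds n : (0 < n)%N ->
  sigma ^+ 4 * A1 < n%:R ^+ 2 * limn (psum (fun j => w n j ^+ 2)) < sigma ^+ 4 * A2.
Proof.
move=> n0; have := hA n0; set s := limn _.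
have s40 : 0 < sigma ^+ 4 by rewrite exprn_gt0.
rewrite -[_ * _ * s]mulrA -(ltr_pM2l s40) -[X in _ && X](ltr_pM2l s40).
by rewrite !mulrA mulfV ?mul1r// gt_eqF.
Qed.

(** The sum of squared weights is comparable with [w n 1 * rho w n]; A2 fixes the order of the
    former and A3 that of [rho], so the order of [w n 1] follows. *)
Lemma w1_upper n : (0 < n)%N -> n%:R ^+ 2 * (y n * w n 1%N) <= Kup.
Proof.
move=> n0; have [_ _ h] := sq_sum n0; have /andP[_ hs] := sq_sum_bounds n0.
have /andP[hr _] := hrho n0.
have n2 : 0 <= n%:R ^+ 2 :> R by rewrite exprn_ge0.
rewrite /Kup ler_pdivlMr//.
apply: le_trans (_ : n%:R ^+ 2 * (w n 1%N * rho w n) <= _).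
  rewrite -mulrA; apply: ler_wpM2l => //.
  by have := ler_wpM2l (w_ge0 n 1%N) hr; lra.
apply: le_trans (ler_wpM2l n2 h) _.
rewrite mulrCA; apply: ler_wpM2l; last exact: ltW.
by rewrite mulr_ge0// sqr_ge0.
Qed.

Lemma w1_lower n : (0 < n)%N -> Klo <= n%:R ^+ 2 * (y n * w n 1%N).
Proof.
move=> n0; have [_ h _] := sq_sum n0; have /andP[hs _] := sq_sum_bounds n0.
have /andP[_ hr] := hrho n0.
have n2 : 0 <= n%:R ^+ 2 :> R by rewrite exprn_ge0.
rewrite /Klo ler_pdivrMr//; apply: le_trans (ltW hs) _.
rewrite -[leRHS]mulrA; apply: ler_wpM2l => //; apply: le_trans h _.
by have := ler_wpM2l (w_ge0 n 1%N) hr; lra.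
Qed.

Lemma acoef_ge0 n j : 0 <= a n j.
Proof. by apply: mulr_ge0 => //; apply: mulr_ge0; rewrite ?sqr_ge0 ?ler0n. Qed.

Lemma acoef_le n j : (0 < j)%N -> a n j <= a n 1%N.
Proof.
by move=> j0; rewrite /acoef; apply: ler_wpM2l; [rewrite mulr_ge0 ?sqr_ge0|exact: w_anti].
Qed.

(** By [w1_upper], [a n 1] is at most a constant times [n^(2r - 1)], and [r < 1 / 2]. *)
Lemma acoef_small e : 0 < e -> \forall n \near \oo, a n 1%N <= e.
Proof.
move=> e0; pose M : R := sigma ^+ 2 * Kup / e.
have s0 : 0 < 1 - 2 * r by move: r_lt; lra.
have M0 : 0 < M by rewrite divr_gt0// mulr_gt0 ?exprn_gt0// Kup_gt0.
near=> n.
have n0 : (0 < n)%N by near: n; exact: nbhs_infty_gt.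
have nR : 0 < n%:R :> R by rewrite ltr0n.
have nM : M `^ (1 - 2 * r)^-1 <= n%:R by near: n; exact: nbhs_infty_ger.
have ny : M <= n%:R * y n.
  have -> : n%:R * y n = n%:R `^ (1 - 2 * r).
    by rewrite -{1}(powRr1 (ltW nR)) -powRD// (gt_eqF nR) implybT.
  have -> : M = (M `^ (1 - 2 * r)^-1) `^ (1 - 2 * r).
    by rewrite -powRrM mulVf ?gt_eqF// powRr1// ltW.
  by rewrite ge0_ler_powR// ?nnegrE ?powR_ge0// ltW.
have ny0 : 0 < n%:R * y n by rewrite mulr_gt0// y_gt0.
have up := w1_upper n0.
rewrite -(ler_pM2r ny0).
have -> : a n 1%N * (n%:R * y n) = sigma ^+ 2 * (n%:R ^+ 2 * (y n * w n 1%N)).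
  by rewrite /acoef; ring.
apply: le_trans (_ : sigma ^+ 2 * Kup <= _); first by rewrite ler_pM2l ?exprn_gt0.
by move: ny; rewrite /M ler_pdivrMr// [leRHS]mulrC.
Unshelve. all: by end_near. Qed.

Lemma dcoef_ge0 n j : 0 <= dd n j.
Proof. by apply: mulr_ge0; [apply: mulr_ge0 => //|]; exact: sqr_ge0. Qed.

Lemma theta_sum_bound n : (0 < n)%N ->
  n%:R ^+ 2 * w n 1%N * limn (psum (fun j => theta n j ^+ 2)) <= Kup * C ^+ 2.
Proof.
move=> n0; have th := theta_le n0; have up := w1_upper n0.
have c0 : 0 <= n%:R ^+ 2 * w n 1%N by rewrite mulr_ge0// exprn_ge0.
apply: le_trans (ler_wpM2l c0 th) _.
have := ler_wpM2r (sqr_ge0 C) up; lra.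
Qed.

Lemma psum_dcoef_le n N : (0 < n)%N -> psum (dd n) N <= Kup * C ^+ 2.
Proof.
move=> n0; apply: le_trans (theta_sum_bound n0).
have c0 : 0 <= n%:R ^+ 2 * w n 1%N by rewrite mulr_ge0// exprn_ge0.
apply: (@le_trans _ _ (psum (fun j => n%:R ^+ 2 * w n 1%N * theta n j ^+ 2) N)).
  apply: le_psum => j j0; rewrite /dcoef; apply: ler_wpM2r; first exact: sqr_ge0.
  by apply: ler_wpM2l; [rewrite exprn_ge0|exact: w_anti].
rewrite psumZ; apply: ler_wpM2l => //; apply: psum_le_lim => // j.
exact: sqr_ge0.
Qed.

Definition Dlim n : R := limn (psum (dd n)).

Lemma dcoef_cvg n : (0 < n)%N -> psum (dd n) @ \oo --> Dlim n.
Proof.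
by move=> n0; have [] := psum_cvg_bounded (dcoef_ge0 n) (fun N => psum_dcoef_le N n0).
Qed.

Lemma Dlim_ge0 n : (0 < n)%N -> 0 <= Dlim n.
Proof.
move=> n0; apply: le_trans (psum_le_lim 0 (dcoef_ge0 n) (dcoef_cvg n0)).
by rewrite psum_ge0// => j _; exact: dcoef_ge0.
Qed.

Lemma bcoef_sqr n j : (0 < n)%N -> b n j ^+ 2 = a n j * dd n j.
Proof.
move=> n0; have nR : 0 < n%:R :> R by rewrite ltr0n.
rewrite /bcoef /acoef /dcoef exprMn expr_div_n sqr_sqrtr ?ltW//.
by field; exact: lt0r_neq0.
Qed.

Lemma bcoef_le n j : (0 < n)%N -> (0 < j)%N ->
  b n j ^+ 2 <= a n 1%N * (Kup * C ^+ 2).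
Proof.
move=> n0 j0; rewrite bcoef_sqr//; apply: ler_pM; [exact: acoef_ge0|exact: dcoef_ge0|exact: acoef_le|].
apply: le_trans (psum_dcoef_le j.+1 n0).
exact: term_le_psum (dcoef_ge0 n).
Qed.

(** The linear part contributes vanishing variance: [b_j^2 = a_j d_j], with [a_j <= a_1] small and
    the [d_j] of bounded sum. *)
Lemma psum_bsqr_le n N : (0 < n)%N ->
  psum (fun j => b n j ^+ 2) N <= a n 1%N * (Kup * C ^+ 2).
Proof.
move=> n0; apply: (@le_trans _ _ (psum (fun j => a n 1%N * dd n j) N)).
  apply: le_psum => j j0; rewrite bcoef_sqr//; apply: ler_wpM2r; first exact: dcoef_ge0.
  exact: acoef_le.
by rewrite psumZ; apply: ler_wpM2l; [exact: acoef_ge0|exact: psum_dcoef_le].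
Qed.

Definition Alim n : R := limn (psum (fun j => a n j ^+ 2)).

Definition Blim n : R := limn (psum (fun j => b n j ^+ 2)).

(** The power 8 is [4 + 4]: one [sigma^4] from the squared coefficients, one to cancel the
    [sigma^-4] of A2. *)
Lemma asqr_cvg n : (0 < n)%N -> psum (fun j => a n j ^+ 2) @ \oo --> Alim n /\
  sigma ^+ 8 * A1 <= Alim n <= sigma ^+ 8 * A2.
Proof.
move=> n0; have [cw _ _] := sq_sum n0; have /andP[h1 h2] := sq_sum_bounds n0.
have c : psum (fun j => a n j ^+ 2) @ \oo -->
    sigma ^+ 4 * n%:R ^+ 2 * limn (psum (fun j => w n j ^+ 2)).
  have -> : (fun j => a n j ^+ 2) = (fun j => sigma ^+ 4 * n%:R ^+ 2 * w n j ^+ 2).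
    by apply/funext => j; rewrite /acoef; ring.
  exact: cvg_psumM.
have AE : Alim n = sigma ^+ 4 * n%:R ^+ 2 * limn (psum (fun j => w n j ^+ 2)).
  exact: cvg_lim c.
rewrite AE; split => //.
have s4 : 0 <= sigma ^+ 4 by rewrite exprn_ge0// ltW.
have := ler_wpM2l s4 (ltW h1); have := ler_wpM2l s4 (ltW h2).
move: (limn _) => s k2 k1.
have e8 : sigma ^+ 8 = sigma ^+ 4 * sigma ^+ 4 by rewrite -exprD.
by rewrite e8 -!mulrA in k1 k2 *; rewrite k1 k2.
Qed.

Lemma bsqr_cvg n : (0 < n)%N -> psum (fun j => b n j ^+ 2) @ \oo --> Blim n /\
  0 <= Blim n <= a n 1%N * (Kup * C ^+ 2).
Proof.
move=> n0; have b0 j : 0 <= b n j ^+ 2 by exact: sqr_ge0.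
have [c l] := psum_cvg_bounded b0 (fun N => psum_bsqr_le N n0).
split => //; rewrite /Blim l andbT; apply: le_trans (psum_le_lim 0 b0 c).
by rewrite psum_ge0// => j _.
Qed.

Lemma vsumE (al be : nat -> R) N : vsum al be N =
  tau R * psum (fun j => al j ^+ 2) N + 4 * mu2 R * psum (fun j => be j ^+ 2) N.
Proof. by rewrite /vsum /psum !mulr_sumr -big_split. Qed.

Lemma qsumE (al be : nat -> R) N : qsum al be N =
  psum (fun j => al j ^+ 2) N + psum (fun j => be j ^+ 2) N.
Proof. by rewrite /qsum /psum -big_split. Qed.

Lemma qsum_le n N : (0 < n)%N -> a n 1%N <= 1 ->
  qsum (a n) (b n) N <= sigma ^+ 8 * A2 + Kup * C ^+ 2.
Proof.
move=> n0 a1; have [ca /andP[_ hA2]] := asqr_cvg n0.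
rewrite qsumE lerD//.
  apply: le_trans hA2; apply: psum_le_lim => [j|]; first exact: sqr_ge0.
  by apply/cvg_ex; exists (Alim n).
apply: le_trans (psum_bsqr_le N n0) _; rewrite ler_piMl// mulr_ge0 ?sqr_ge0// ltW//.
exact: Kup_gt0.
Qed.

Lemma vsum_cvg n : (0 < n)%N ->
  vsum (a n) (b n) @ \oo --> tau R * Alim n + 4 * mu2 R * Blim n.
Proof.
move=> n0; have [ca _] := asqr_cvg n0; have [cb _] := bsqr_cvg n0.
rewrite (_ : vsum (a n) (b n) = (fun N => tau R * psum (fun j => a n j ^+ 2) N
   + 4 * mu2 R * psum (fun j => b n j ^+ 2) N)); last first.
  by apply/funext => N; exact: vsumE.
by apply: (@cvgD _ R^o); apply: cvgM => //; exact: cvg_cst.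
Qed.

Lemma low_frequency_of_shift (delta lambda C1 : R) : 0 < delta -> 0 < C1 -> 1 < lambda ->
  (forall delta0 : R, 0 < delta0 -> forall n, (0 < n)%N ->
     w n (Num.truncn ((1 + delta0) * (kn n)%:R))
       < C1 * (1 + delta0) `^ (- lambda) * w n (kn n)) ->
  (\forall n \near \oo, delta <= Dlim n) ->
  exists (c1 c2 : R) (n0 : nat), 0 < c1 /\ 0 < c2 /\
     forall n, (n0 < n)%N -> c1 * y n <
       \sum_(1 <= j < (Num.truncn (c2 * (kn n)%:R)).+1 | j%:R < c2 * (kn n)%:R)
          theta n j ^+ 2.
Proof.
move=> d0 C10 lam1 hA4 [n0 _ Dn].
have KC : 0 < Kup * C ^+ 2 by rewrite mulr_gt0 ?Kup_gt0// exprn_gt0.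
(* Chosen so that frequencies beyond the cutoff contribute at most
   [C1 * eps * (Kup * C^2) = delta / 2]. *)
pose eps : R := delta / (2 * (C1 * (Kup * C ^+ 2))).
have eps0 : 0 < eps by rewrite divr_gt0// mulr_gt0// mulr_gt0.
(* Since [lambda > 1], [(1 + de)^(- lambda) <= (1 + de)^(-1) <= eps]. *)
pose de : R := 1 + eps^-1.
have de0 : 0 < de by rewrite addr_gt0// invr_gt0.
have Kp := Kup_gt0.
(* Low frequencies keep [delta / 2]; the remaining factor 2 makes the final inequality strict. *)
exists (delta / (4 * Kup)), (1 + de), n0.
split; first by rewrite divr_gt0// mulr_gt0.
split; first by rewrite addr_gt0.
move=> n nn0; have n1 : (0 < n)%N by apply: leq_ltn_trans nn0.
set x := (1 + de) * (kn n)%:R; set F := \sum_(_ <= _ < _ | _) _.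
have small : (1 + de) `^ (- lambda) <= eps.
  have d1 : 1 <= 1 + de by rewrite lerDl ltW.
  apply: le_trans (_ : (1 + de) `^ (- 1) <= _).
    by rewrite ler_powR// lerN2 ltW.
  rewrite powRN powRr1; last by rewrite addr_ge0// ltW.
  have ei : 0 < eps^-1 by rewrite invr_gt0.
  have dp : 0 < 1 + de by rewrite addr_gt0.
  by rewrite -[leRHS]invrK lef_pV2 ?posrE// /de; lra.
have k0 : 1 <= (kn n)%:R :> R by rewrite ler1n kn_ge1.
have x1 : 1 <= x.
  rewrite /x; apply: le_trans k0 _; rewrite ler_peMl ?ler0n// lerDl ltW//.
have x0 : 0 <= x by apply: le_trans x1.
have m1 : (1 <= Num.truncn x)%N by rewrite truncn_ge_nat.
have wx : w n (Num.truncn x) <= C1 * eps * w n 1%N.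
  apply: le_trans (ltW (hA4 de de0 n n1)) _.
  apply: ler_pM => //; last exact: wk_le_w1.
    by rewrite mulr_ge0 ?powR_ge0// ltW.
  by rewrite ler_pM2l.
have n2 : 0 <= n%:R ^+ 2 :> R by rewrite exprn_ge0.
have th0 j : 0 <= theta n j ^+ 2 by exact: sqr_ge0.
have bound N : psum (dd n) N <= n%:R ^+ 2 * w n 1%N * F + delta / 2.
  have tail : psum (dd n) N <= n%:R ^+ 2 * w n 1%N * \sum_(1 <= j < N | j%:R < x) theta n j ^+ 2
      + n%:R ^+ 2 * (C1 * eps * w n 1%N) * psum (fun j => theta n j ^+ 2) N.
    rewrite /psum [X in _ <= _ * X + _]big_mkcond/= !mulr_sumr -big_split/=.
    apply: ler_sum_nat => j /andP[j1 _]; rewrite /dcoef.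
    case: ifPn => jx.
      rewrite -[leLHS]addr0 lerD//.
        by apply: ler_wpM2r => //; apply: ler_wpM2l => //; exact: w_anti.
      by apply: mulr_ge0 => //; apply: mulr_ge0 => //; apply: mulr_ge0 => //; exact/ltW/mulr_gt0.
    rewrite mulr0 add0r; apply: ler_wpM2r => //; apply: ler_wpM2l => //.
    apply: le_trans wx; apply: w_anti; rewrite m1/=.
    move: jx; rewrite -leNgt => xj.
    by rewrite -(ler_nat R); apply: le_trans xj; rewrite truncn_le.
  apply: le_trans tail _; apply: lerD.
    by apply: ler_wpM2l; [rewrite mulr_ge0|exact: filtered_psum_le].
  have ps : psum (fun j => theta n j ^+ 2) N <= limn (psum (fun j => theta n j ^+ 2)).
    exact: psum_le_lim.
  have tb := theta_sum_bound n1.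
  apply: le_trans (_ : C1 * eps * (n%:R ^+ 2 * w n 1%N * limn (psum (fun j => theta n j ^+ 2))) <= _).
    have c0 : 0 <= n%:R ^+ 2 * (C1 * eps * w n 1%N).
      by apply: mulr_ge0 => //; apply: mulr_ge0 => //; exact/ltW/mulr_gt0.
    by have := ler_wpM2l c0 ps; lra.
  apply: le_trans (_ : C1 * eps * (Kup * C ^+ 2) <= _).
    by rewrite ler_pM2l// mulr_gt0.
  by rewrite le_eqVlt; apply/orP; left; apply/eqP; rewrite /eps; field; rewrite !lt0r_neq0// exprn_gt0.
have Dle : Dlim n <= n%:R ^+ 2 * w n 1%N * F + delta / 2.
  by apply: limr_le; [apply/cvg_ex; exists (Dlim n); exact: dcoef_cvg|exact: nearW].
have := Dn n (ltnW nn0) => /= dD.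
have up := w1_upper n1; have y0 := y_gt0 n1; have w10 := w1_gt0 n1.
have nw : 0 < n%:R ^+ 2 * w n 1%N by rewrite mulr_gt0// exprn_gt0// ltr0n.
rewrite -(ltr_pM2l nw).
apply: (@lt_le_trans _ _ (delta / 2)); last by move: dD Dle; lra.
apply: (@le_lt_trans _ _ (delta / (4 * Kup) * Kup)).
  have -> : n%:R ^+ 2 * w n 1%N * (delta / (4 * Kup) * y n) =
    delta / (4 * Kup) * (n%:R ^+ 2 * (y n * w n 1%N)) by ring.
  by rewrite ler_pM2l// divr_gt0// mulr_gt0.
have -> : delta / (4 * Kup) * Kup = delta / 4 by field; exact: lt0r_neq0.
by move: d0; lra.
Qed.

Lemma shift_of_low_frequency (c1 c2 : R) (n0 : nat) :
  (forall c0 : R, 1 < c0 -> exists C0 : R, 0 < C0 /\ forall n, (0 < n)%N ->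
     C0 * w n (kn n) <= w n (Num.truncn (c0 * (kn n)%:R))) ->
  0 < c1 -> 0 < c2 ->
  (forall n, (n0 < n)%N -> c1 * y n <
     \sum_(1 <= j < (Num.truncn (c2 * (kn n)%:R)).+1 | j%:R < c2 * (kn n)%:R)
        theta n j ^+ 2) ->
  exists2 delta : R, 0 < delta & \forall n \near \oo, delta <= Dlim n.
Proof.
move=> hA5 c10 c20 low.
(* The constant [2 + c2] exceeds both 1, as A5 demands, and [c2], so monotonicity carries the weight
   bound to every [j < c2 * k_n]. *)
have c0lt : 1 < 2 + c2 by lra.
have [C0 [C00 C0P]] := hA5 _ c0lt.
exists (C0 / q * c1 * Klo); first by rewrite !mulr_gt0 ?invr_gt0// Klo_gt0.
exists n0.+1 => // n /= nn0.
have n1 : (0 < n)%N by apply: leq_ltn_trans nn0.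
have {}low := low n nn0.
set x := c2 * (kn n)%:R in low; set M := (Num.truncn x).+1 in low.
set F := \sum_(_ <= _ < _ | _) _ in low.
have n2 : 0 <= n%:R ^+ 2 :> R by rewrite exprn_ge0.
have k0 : 0 <= (kn n)%:R :> R by rewrite ler0n.
have wlow : C0 / q * w n 1%N <= w n (Num.truncn ((2 + c2) * (kn n)%:R)).
  apply: le_trans (C0P n n1); rewrite -mulrA ler_pM2l// ler_pdivrMl//.
  exact: w1_wk.
have FD : n%:R ^+ 2 * (C0 / q * w n 1%N) * F <= Dlim n.
  apply: le_trans (psum_le_lim M (dcoef_ge0 n) (dcoef_cvg n1)).
  rewrite /F /psum [X in _ * X]big_mkcond/= mulr_sumr.
  apply: ler_sum_nat => j /andP[j1 _]; case: ifPn => [jx|_]; last first.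
    by rewrite mulr0; exact: dcoef_ge0.
  apply: ler_wpM2r; first exact: sqr_ge0.
  apply: ler_wpM2l => //; apply: le_trans wlow _; apply: w_anti; rewrite j1/=.
  rewrite truncn_ge_nat; last by rewrite mulr_ge0// ltW// (lt_trans _ c0lt).
  apply: le_trans (ltW jx) _; rewrite /x; apply: ler_wpM2r => //.
  by rewrite lerDr.
apply: le_trans FD.
have lo := w1_lower n1.
have cq : 0 < C0 / q by rewrite divr_gt0.
apply: le_trans (_ : n%:R ^+ 2 * (C0 / q * w n 1%N) * (c1 * y n) <= _); last first.
  apply: ler_wpM2l; last exact: ltW.
  by apply: mulr_ge0 => //; apply: mulr_ge0 => //; exact: ltW.
have -> : n%:R ^+ 2 * (C0 / q * w n 1%N) * (c1 * y n) =
  C0 / q * c1 * (n%:R ^+ 2 * (y n * w n 1%N)) by ring.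
by rewrite ler_pM2l// mulr_gt0.
Qed.

End Weights.

(** * Consistency *)

Lemma Phi0_lt1 (R : realType) : 0 < Phi (0 : R) < 1.
Proof.
have [k k0 gap] := @Phi_gap R 1 1 ltr01.
have := gap 0; rewrite normr0 sub0r ler01 => /(_ isT).
have := gap 1; rewrite normr1 lexx subrr => /(_ isT).
have := Phi_ge0 (- 1 : R); have := Phi_le1 (1 : R); lra.
Qed.

Lemma sqr_powRN (R : realType) (x r : R) : 0 <= x -> (x `^ (- r)) ^+ 2 = x `^ (- (2 * r)).
Proof.
move=> x0; rewrite -powR_mulrn ?powR_ge0// -powRrM; congr (_ `^ _); ring.
Qed.

Section UniformClt.
Context (d : measure_display) (T : measurableType d) (R : realType).
Variables (P : probability T R) (xi : nat -> {RV P >-> R}).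
Hypothesis xi_iid : iid_std_normal xi.
Variables (sigma r : R) (w : nat -> nat -> R) (kn : nat -> nat).
Variables (A1 A2 p1 p2 q : R).
Hypotheses (sigma_gt0 : 0 < sigma) (r_lt : r < 1 / 2).
Hypothesis w_ge0 : forall n j, 0 <= w n j.
Hypothesis w_cvg : forall n, cvgn (psum (w n)).
Hypothesis kn_spec : forall n, (0 < n)%N -> is_kn w n (kn n).
Hypothesis w_anti : forall n i j, (1 <= i <= j)%N -> w n j <= w n i.
Hypotheses (A1_gt0 : 0 < A1) (A2_gt0 : 0 < A2) (p1_gt0 : 0 < p1) (q_gt0 : 0 < q).
Hypothesis hA : forall n, (0 < n)%N ->
  A1 < sigma ^- 4 * n%:R ^+ 2 * limn (psum (fun j => w n j ^+ 2)) < A2.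
Hypothesis hrho : forall n, (0 < n)%N ->
  p1 * n%:R `^ (- (2 * r)) <= rho w n <= p2 * n%:R `^ (- (2 * r)).
Hypothesis wk_gt0 : forall n, (0 < n)%N -> 0 < w n (kn n).
Hypothesis w1_wk : forall n, (0 < n)%N -> w n 1%N <= q * w n (kn n).

(** Stated for any [theta] within the norm bound, so that [theta = 0] gives the approximation under
    the hypothesis. *)
Lemma typeII_uniform_clt (theta : nat -> nat -> R) (C eta : R) : 0 < C ->
  (forall n, cvgn (psum (fun j => theta n j ^+ 2))) ->
  (forall n, (0 < n)%N ->
    limn (psum (fun j => theta n j ^+ 2)) <= C ^+ 2 * n%:R `^ (- (2 * r))) ->
  0 < eta -> \forall n \near \oo, forall t,
  `|fine (typeII xi sigma w (theta n) n t)
    - Phi ((null_threshold sigma w n t - Dlim w theta n)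
        / Num.sqrt (tau R * Alim sigma w n + 4 * mu2 R * Blim sigma w theta n))| <= eta.
Proof.
move=> C0 thc thl eta0.
have K0 : 0 < Kup sigma A2 p1 q by exact: Kup_gt0.
set K := Kup sigma A2 p1 q * C ^+ 2.
have Kp : 0 < K by rewrite mulr_gt0// exprn_gt0.
have s8 : 0 < sigma ^+ 8 by rewrite exprn_gt0.
have t0 := tau_gt0 R.
(* Half of the lower bound on the variance, to get the strict inequality of [typeII_clt]. *)
have lo0 : 0 < tau R * (sigma ^+ 8 * A1) / 2 by rewrite divr_gt0// !mulr_gt0.
have hi0 : 0 < sigma ^+ 8 * A2 + K by rewrite addr_gt0// mulr_gt0.
have [e e0 eP] := typeII_clt xi_iid sigma w_ge0 w_cvg lo0 hi0 eta0.
have small (m : R) : 0 < m -> \forall n \near \oo, acoef sigma w n 1%N <= m.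
  exact: (acoef_small sigma_gt0 r_lt w_ge0 w_cvg kn_spec w_anti A2_gt0 p1_gt0 q_gt0 hA hrho
    wk_gt0 w1_wk).
have e2K : 0 < e ^+ 2 / K by rewrite divr_gt0// exprn_gt0.
have S1 := small 1 ltr01; have S2 := small e e0; have S3 := small _ e2K.
near=> n => t.
have n0 : (0 < n)%N by near: n; exact: nbhs_infty_gt.
have a1 : acoef sigma w n 1%N <= 1 by near: n.
have a2 : acoef sigma w n 1%N <= e by near: n.
have a3 : acoef sigma w n 1%N <= e ^+ 2 / K by near: n.
apply: eP => //.
- move=> j j0; rewrite ger0_norm; last exact: acoef_ge0.
  by apply: le_trans a2; exact: acoef_le.
- move=> j j0; rewrite -ler_sqr ?nnegrE ?normr_ge0 ?(ltW e0)// real_normK ?num_real//.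
  apply: le_trans (_ : acoef sigma w n 1%N * K <= _); first exact: (bcoef_le sigma_gt0 w_ge0 w_cvg kn_spec w_anti p1_gt0 hA hrho
    wk_gt0 w1_wk thc thl n0 j0).
  by rewrite -ler_pdivlMr.
- exact: (vsum_cvg sigma_gt0 w_ge0 w_cvg kn_spec w_anti p1_gt0 hA hrho
    wk_gt0 w1_wk thc thl n0).
- have [_ /andP[hl _]] := asqr_cvg sigma_gt0 w_ge0 w_cvg kn_spec w_anti hA wk_gt0 w1_wk n0.
  have [_ /andP[hb _]] := bsqr_cvg sigma_gt0 w_ge0 w_cvg kn_spec w_anti p1_gt0 hA hrho
    wk_gt0 w1_wk thc thl n0.
  have hm : 0 <= 4 * mu2 R * Blim sigma w theta n.
    by rewrite mulr_ge0// mulr_ge0// mu2_ge0.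
  have := ler_wpM2l (ltW t0) hl.
  by move: lo0; lra.
- move=> N; exact: (qsum_le sigma_gt0 w_ge0 w_cvg kn_spec w_anti A2_gt0 p1_gt0 q_gt0
    hA hrho wk_gt0 w1_wk thc thl N n0 a1).
- exact: (dcoef_cvg sigma_gt0 w_ge0 w_cvg kn_spec w_anti p1_gt0 hA hrho
    wk_gt0 w1_wk thc thl n0).
Unshelve. all: by end_near. Qed.

Lemma Dlim0 n : Dlim w (fun _ _ => 0) n = 0 :> R.
Proof.
rewrite /Dlim (_ : psum _ = fun=> 0) ?lim_cst//.
by apply/funext => N; rewrite /psum big1// => j _; rewrite /dcoef expr0n mulr0.
Qed.

Lemma Blim0 n : Blim sigma w (fun _ _ => 0) n = 0 :> R.
Proof.
rewrite /Blim (_ : psum _ = fun=> 0) ?lim_cst//.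
by apply/funext => N; rewrite /psum big1// => j _; rewrite /bcoef mulr0 mul0r expr0n.
Qed.

Lemma typeII_null_clt (eta : R) : 0 < eta -> \forall n \near \oo, forall t,
  `|fine (typeII xi sigma w (fun=> 0) n t)
    - Phi (null_threshold sigma w n t / Num.sqrt (tau R * Alim sigma w n))| <= eta.
Proof.
move=> eta0.
have z2 : psum (fun=> (0 : R) ^+ 2) = fun=> 0.
  by apply/funext => N; rewrite /psum big1// => j _; rewrite expr0n.
have := @typeII_uniform_clt (fun _ _ => 0) 1 eta ltr01.
move=> /(_ _ _ eta0); case.
- by move=> n; rewrite z2; exact: is_cvg_cst.
- by move=> n n0; rewrite z2 lim_cst// expr1n mul1r powR_ge0.
move=> n0 _ nP; exists n0 => // n /nP /= h t.
by have := h t; rewrite Dlim0 Blim0 subr0 mulr0 addr0.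
Qed.


Lemma consistent_iff_shift (theta : nat -> nat -> R) (C : R) : 0 < C ->
  (forall n, cvgn (psum (fun j => theta n j ^+ 2))) ->
  (forall n, (0 < n)%N ->
    limn (psum (fun j => theta n j ^+ 2)) <= C ^+ 2 * n%:R `^ (- (2 * r))) ->
  consistent xi sigma w theta <->
  exists2 delta : R, 0 < delta & \forall n \near \oo, delta <= Dlim w theta n.
Proof.
move=> C0 thc thl.
pose bet n t := fine (typeII xi sigma w (theta n) n t).
pose gam n t := fine (typeII xi sigma w (fun=> 0) n t).
pose V0 n := tau R * Alim sigma w n.
pose V n := tau R * Alim sigma w n + 4 * mu2 R * Blim sigma w theta n.
set K := Kup sigma A2 p1 q * C ^+ 2.
have Kp : 0 < K by rewrite mulr_gt0 ?exprn_gt0//; exact: Kup_gt0.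
have t0 := tau_gt0 R; have m0 := mu2_ge0 R.
have s8 : 0 < sigma ^+ 8 by rewrite exprn_gt0.
have lo0 : 0 < tau R * (sigma ^+ 8 * A1) by rewrite !mulr_gt0.
have Ab n : (0 < n)%N -> sigma ^+ 8 * A1 <= Alim sigma w n <= sigma ^+ 8 * A2.
  by move=> n0; have [] := asqr_cvg sigma_gt0 w_ge0 w_cvg kn_spec w_anti hA wk_gt0 w1_wk n0.
have Bb n : (0 < n)%N -> 0 <= Blim sigma w theta n <= acoef sigma w n 1%N * K.
  by move=> n0; have [] := bsqr_cvg sigma_gt0 w_ge0 w_cvg kn_spec w_anti p1_gt0 hA hrho
    wk_gt0 w1_wk thc thl n0.
have small (m : R) : 0 < m -> \forall n \near \oo, acoef sigma w n 1%N <= m.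
  exact: (acoef_small sigma_gt0 r_lt w_ge0 w_cvg kn_spec w_anti A2_gt0 p1_gt0 q_gt0 hA hrho
    wk_gt0 w1_wk).
have D0 n : (0 < n)%N -> 0 <= Dlim w theta n by exact: (Dlim_ge0 sigma_gt0 w_ge0 w_cvg kn_spec w_anti p1_gt0 hA hrho
    wk_gt0 w1_wk thc thl).
have V0lo n : (0 < n)%N -> tau R * (sigma ^+ 8 * A1) <= V0 n.
  by move=> n0; rewrite ler_pM2l//; have /andP[] := Ab n n0.
have V0V n : (0 < n)%N -> V0 n <= V n.
  by move=> n0; rewrite lerDl mulr_ge0 ?mulr_ge0//; have /andP[] := Bb n n0.
have mk : 0 <= 4 * mu2 R * K.
  by apply: mulr_ge0; [apply: mulr_ge0; rewrite ?ler0n|exact: ltW].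
have hi0 : 0 < tau R * (sigma ^+ 8 * A2) + 4 * mu2 R * K.
  by apply: ltr_wpDr => //; rewrite mulr_gt0// mulr_gt0.
have VV0 n : (0 < n)%N -> V n - V0 n <= 4 * mu2 R * (acoef sigma w n 1%N * K).
  move=> n0; rewrite /V /V0 addrAC subrr add0r; apply: ler_wpM2l; first exact: mulr_ge0.
  by have /andP[] := Bb n n0.
have Vhi : \forall n \near \oo, V n <= tau R * (sigma ^+ 8 * A2) + 4 * mu2 R * K.
  have S1 := small 1 ltr01; near=> n.
  have n0 : (0 < n)%N by near: n; exact: nbhs_infty_gt.
  have a1 : acoef sigma w n 1%N <= 1 by near: n.
  rewrite lerD//; first by rewrite ler_pM2l//; have /andP[] := Ab n n0.
  apply: ler_wpM2l; first exact: mulr_ge0.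
  by have /andP[_ h] := Bb n n0; apply: le_trans h _; rewrite ler_piMl// ltW.
have Vclose eta : 0 < eta -> \forall n \near \oo, V n - V0 n <= eta.
  move=> eta0; have e0 : 0 < eta / (4 * mu2 R * K + 1).
    by rewrite divr_gt0// ltr_wpDl.
  have S1 := small _ e0; near=> n.
  have n0 : (0 < n)%N by near: n; exact: nbhs_infty_gt.
  have a1 : acoef sigma w n 1%N <= eta / (4 * mu2 R * K + 1) by near: n.
  apply: le_trans (VV0 n n0) _.
  have a0 : 0 <= acoef sigma w n 1%N by exact: acoef_ge0.
  move: a1; rewrite ler_pdivlMr ?ltr_wpDl//.
  by rewrite mulrDr mulr1; lra.
have gclt eta : 0 < eta -> \forall n \near \oo, forall t,
    `|gam n t - Phi (null_threshold sigma w n t / Num.sqrt (V0 n))| <= eta.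
  by move=> eta0; exact: typeII_null_clt.
have bclt eta : 0 < eta -> \forall n \near \oo, forall t,
    `|bet n t - Phi ((null_threshold sigma w n t - Dlim w theta n) / Num.sqrt (V n))| <= eta.
  by move=> eta0; exact: (typeII_uniform_clt C0 thc thl eta0).
have ge0 (t : nat -> R) n : (0 <= typeII xi sigma w (theta n) n (t n))%E by exact: measure_ge0.
have finII th n t : (0 < n)%N -> typeII xi sigma w th n t = (fine (typeII xi sigma w th n t))%:E.
  by move=> n0; rewrite fineK//; exact: typeII_fin_num.
have betE (t : nat -> R) (l kappa : R) :
    (\forall n \near \oo, (typeII xi sigma w (theta n) n (t n) <= (l - kappa)%:E)%E) <->
    (\forall n \near \oo, bet n (t n) <= l - kappa).
  have nz : \forall n \near \oo, (0 < n)%N by exact: nbhs_infty_gt.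
  split; apply: filterS2 nz => n n0; rewrite finII//.
split.
- move=> cons.
  have alpha01 : 0 < 1 - Phi (0 : R) < 1 by have := Phi0_lt1 R; lra.
  (* Solves [null_threshold = 0], so that the level tends to [1 - Phi 0] whatever the variances. *)
  pose t n : R := (mu2 R - 1) * (sigma ^+ 2 * n%:R * rho w n) / n%:R ^+ 2.
  have X0 n : (0 < n)%N -> null_threshold sigma w n (t n) = 0.
    move=> n0; rewrite /null_threshold /t.
    by field; rewrite pnatr_eq0 -lt0n.
  have gcv : (fun n => gam n (t n)) @ \oo --> (Phi 0 : R).
    apply/cvgrPdist_le => eta eta0; have G := gclt eta eta0; near=> n.
    have n0 : (0 < n)%N by near: n; exact: nbhs_infty_gt.
    have /(_ (t n)) : forall t,
      `|gam n t - Phi (null_threshold sigma w n t / Num.sqrt (V0 n))| <= eta by near: n.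
    by rewrite X0// mul0r distrC.
  have tI : (fun n => typeI xi sigma w n (t n)) @ \oo --> (1 - Phi 0)%:E.
    have E : (fun n => (1 - gam n (t n))%:E) @ \oo --> (1 - Phi 0)%:E.
      by apply: cvg_EFin; [exact: nearW|apply: (@cvgB _ R^o) => //; exact: cvg_cst].
    apply: cvg_trans E; apply: near_eq_cvg; near=> n.
    have n0 : (0 < n)%N by near: n; exact: nbhs_infty_gt.
    by rewrite typeI_typeII// finII// EFinB.
  have := cons _ alpha01 t tI; rewrite limn_esup_ltP// subKr => -[kappa k0 /betE bk].
  exact: (shift_of_power_gap lo0 D0 V0lo V0V bclt k0 X0 bk).
- move=> [delta d0 dD] alpha alpha01 t tI; apply/limn_esup_ltP => //.
  have gcv : (fun n => gam n (t n)) @ \oo --> 1 - alpha.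
    move/fine_cvg : tI => tI.
    have E : (fun n => 1 - fine (typeI xi sigma w n (t n))) @ \oo --> 1 - alpha.
      by apply: (@cvgB _ R^o) => //; exact: cvg_cst.
    apply: cvg_trans E; apply: near_eq_cvg; near=> n.
    have n0 : (0 < n)%N by near: n; exact: nbhs_infty_gt.
    by rewrite typeI_typeII// finII//= /gam; ring.
  have [kappa k0 kP] := power_gap_of_shift lo0 V0lo V0V hi0 Vhi Vclose gclt bclt d0 alpha01 dD gcv.
  by exists kappa => //; apply/betE.
Unshelve. all: by end_near. Qed.

End UniformClt.

Theorem theorem3 (R : realType) (d : measure_display) (T : measurableType d)
  (P : probability T R) (xi : nat -> {RV P >-> R})
  (sigma r : R) (w : nat -> nat -> R) (kn : nat -> nat)
  (theta : nat -> nat -> R) (c C : R) :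
  iid_std_normal xi ->
  0 < sigma -> 0 < r -> r < 1 / 2 ->
  (* nonnegative weights kappa_{nj}^2 = w n j, with finite sum rho_n *)
  (forall n j, 0 <= w n j) ->
  (forall n, cvgn (psum (w n))) ->
  (* k_n *)
  (forall n, (0 < n)%N -> is_kn w n (kn n)) ->
  (* A1 *)
  (forall n i j, (1 <= i <= j)%N -> w n j <= w n i) ->
  (* A2 *)
  (exists C1 C2 : R, 0 < C1 /\ 0 < C2 /\ forall n, (0 < n)%N ->
     C1 < sigma ^- 4 * n%:R ^+ 2 * limn (psum (fun j => w n j ^+ 2)) < C2) ->
  (* A3 *)
  (exists c1 c2 : R, 0 < c1 /\ 0 < c2 /\ forall n, (0 < n)%N ->
     c1 * n%:R `^ (- (2 * r)) <= rho w n <= c2 * n%:R `^ (- (2 * r))) ->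
  (* A4 *)
  (exists C1 lambda : R, 0 < C1 /\ 1 < lambda /\
     forall delta : R, 0 < delta -> forall n, (0 < n)%N ->
       w n (Num.truncn ((1 + delta) * (kn n)%:R))
         < C1 * (1 + delta) `^ (- lambda) * w n (kn n)) ->
  (* A5 *)
  (exists c' C' : R, 0 < c' /\ 0 < C' /\ forall n, (0 < n)%N ->
     c' < w n 1%N / w n (kn n) < C') ->
  (forall c0 : R, 1 < c0 -> exists C0 : R, 0 < C0 /\ forall n, (0 < n)%N ->
     C0 * w n (kn n) <= w n (Num.truncn (c0 * (kn n)%:R))) ->
  (* the alternatives f_n: square-summable coefficients, c n^-r <= ||f_n|| <= C n^-r *)
  0 < c -> c < C ->
  (forall n, cvgn (psum (fun j => theta n j ^+ 2))) ->
  (forall n, (0 < n)%N ->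
     c * n%:R `^ (- r) <= Num.sqrt (limn (psum (fun j => theta n j ^+ 2)))
     <= C * n%:R `^ (- r)) ->
  consistent xi sigma w theta <->
  (exists (c1 c2 : R) (n0 : nat), 0 < c1 /\ 0 < c2 /\
     forall n, (n0 < n)%N ->
       c1 * n%:R `^ (- (2 * r)) <
       \sum_(1 <= j < (Num.truncn (c2 * (kn n)%:R)).+1 | j%:R < c2 * (kn n)%:R)
          theta n j ^+ 2).
Proof.
move=> xi_iid sigma0 r0 r_lt w0 wc kns wanti [A1 [A2 [A10 [A20 hA]]]]
  [p1 [p2 [p10 [p20 hrho]]]] [C1 [lam [C10 [lam1 hA4]]]] [q' [q [q'0 [q0 hq]]]]
  hA5 c0 cC thc hth.
have C0 : 0 < C by exact: lt_trans cC.
have wk0 n : (0 < n)%N -> 0 < w n (kn n).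
  move=> n0; rewrite lt_neqAle w0 andbT; apply/eqP => wk.
  (* Division by 0 yields 0, which the positive lower bound of A5 on the ratio excludes. *)
  by have /andP[] := hq n n0; rewrite -wk invr0 mulr0 ltNge ltW.
have w1wk n : (0 < n)%N -> w n 1%N <= q * w n (kn n).
  by move=> n0; have /andP[_ /ltW] := hq n n0; rewrite ler_pdivrMr// wk0.
have thl n : (0 < n)%N ->
    limn (psum (fun j => theta n j ^+ 2)) <= C ^+ 2 * n%:R `^ (- (2 * r)).
  move=> n0; have /andP[_ h] := hth n n0.
  have L0 : 0 <= limn (psum (fun j => theta n j ^+ 2)).
    apply: le_trans (psum_le_lim 0 _ (@thc n)); first by rewrite psum_ge0// => j _; exact: sqr_ge0.
    by move=> j; exact: sqr_ge0.
  rewrite -[leLHS]sqr_sqrtr// -sqr_powRN ?ler0n// -exprMn lerXn2r ?nnegrE ?sqrtr_ge0//.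
  by rewrite mulr_ge0 ?powR_ge0// ltW.
apply: (iff_trans (consistent_iff_shift xi_iid sigma0 r_lt w0 wc kns wanti A10 A20 p10 q0 hA
  hrho wk0 w1wk C0 thc thl)); split.
- move=> [delta d0 dD].
  exact: (low_frequency_of_shift sigma0 w0 wc kns wanti A20 p10 q0 hA hrho wk0 w1wk C0 thc thl
    d0 C10 lam1 hA4 dD).
- move=> [c1 [c2 [n0 [c10 [c20 low]]]]].
  exact: (shift_of_low_frequency sigma0 w0 wc kns wanti A10 p10 p20 q0 hA hrho wk0 w1wk
    thc thl hA5 c10 c20 low).
Qed.
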